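(* Let $\alpha\in\mathbb{C}\setminus\{0,-1\}$ and $\mathfrak{g}=D(2,1,\alpha)$. If $M$ is a cuspidal $\mathfrak{g}$-module, then $\dim M_\lambda=\dim M_\mu$ for all $\lambda,\mu\in\mathfrak{h}^*$ with $\lambda-\mu\in Q_{\bar 0}$.
   Context: The ground field is $\mathbb{C}$. For $\alpha\in\mathbb{C}\setminus\{0,-1\}$, $\mathfrak{g}=\mathfrak{g}_{\bar 0}\oplus\mathfrak{g}_{\bar 1}=D(2,1,\alpha)$ is the contragredient Lie superalgebra $\mathfrak{g}(A)$ with Cartan matrix $$A=(a_{ij})=\begin{pmatrix}0&1&\alpha\\1&0&-\alpha-1\\ \alpha&-\alpha-1&0\end{pmatrix}$$ and three simple roots $\beta_1,\beta_2,\beta_3$, all odd: it is generated by odd $e_i\in\mathfrak{g}_{\beta_i}$, $f_i\in\mathfrak{g}_{-\beta_i}$ and even $h_i$ ($i=1,2,3$), where the $h_i$ form a basis of the Cartan subalgebra $\mathfrak{h}$, with relations $[h_i,h_j]=0$, $[e_i,f_j]=\delta_{ij}h_i$, $[h_i,e_j]=a_{ij}e_j$, $[h_i,f_j]=-a_{ij}f_j$, modulo the maximal ideal intersecting $\mathfrak{h}$ trivially. The even roots are $\Delta_{\bar 0}=\{\pm(\beta_1+\beta_2),\pm(\beta_1+\beta_3),\pm(\beta_2+\beta_3)\}$, and the even root lattice is $Q_{\bar 0}=\mathbb{Z}(\beta_1+\beta_2)+\mathbb{Z}(\beta_1+\beta_3)+\mathbb{Z}(\beta_2+\beta_3)$.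 A weight module is a ($\mathbb{Z}/2\mathbb{Z}$-graded) module with $M=\bigoplus_{\mu\in\mathfrak{h}^*}M_\mu$, $M_\mu=\{m: h m=\mu(h)m\ \forall h\in\mathfrak{h}\}$; it is finite if all $\dim M_\mu<\infty$. A parabolic subalgebra is a subalgebra $\mathfrak{p}=\bigoplus_{j\ge 0}\mathfrak{g}(j)$ arising from a $\mathbb{Z}$-grading $\mathfrak{g}=\bigoplus_{j\in\mathbb{Z}}\mathfrak{g}(j)$ with $[\mathfrak{g}(i),\mathfrak{g}(j)]\subset\mathfrak{g}(i+j)$ and $\mathfrak{h}\subset\mathfrak{g}(0)$. For a simple weight $\mathfrak{p}$-module $S$, the module $\operatorname{Ind}_{\mathfrak{p}}^{\mathfrak{g}}S=U(\mathfrak{g})\otimes_{U(\mathfrak{p})}S$ has a unique simple quotient $L_{\mathfrak{p}}(S)$, which is said to be parabolically induced from $\mathfrak{p}$. A cuspidal $\mathfrak{g}$-module is a simple finite weight $\mathfrak{g}$-module that is not parabolically induced (i.e. not isomorphic to any $L_{\mathfrak{p}}(S)$) from any proper parabolic subalgebra $\mathfrak{p}\subsetneq\mathfrak{g}$. *)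

(* Defs.v *)
From HB Require Import structures.
From mathcomp Require Import all_boot all_order all_algebra.
From mathcomp Require Import boolp classical_sets reals.
From mathcomp Require Import complex freeg.

Set Implicit Arguments.
Unset Strict Implicit.
Unset Printing Implicit Defensive.

Import Order.TTheory GRing.Theory Num.Theory.
Local Open Scope classical_set_scope.
Local Open Scope ring_scope.

Section LinearAlgebra.
Variables (F : fieldType) (V : lmodType F).

Definition linear_sub (W : set V) : Prop :=
  W 0 /\ forall (a : F) u v, W u -> W v -> W (a *: u + v).

Definition lspan (X : set V) : set V :=
  [set v | forall W, linear_sub W -> X `<=` W -> W v].

Definition lin_indep n (b : 'I_n -> V) : Prop :=
  forall c : 'I_n -> F, \sum_i c i *: b i = 0 -> forall i, c i = 0.

Definition has_dim (W : set V) (n : nat) : Prop :=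
  exists b : 'I_n -> V, lin_indep b /\ lspan (range b) = W.

(* V is the direct sum of the subspaces P i. *)
Definition grading (I : choiceType) (P : I -> set V) : Prop :=
  [/\ forall i, linear_sub (P i),
      forall v, exists (s : seq I) (x : I -> V),
        (forall i, P i (x i)) /\ v = \sum_(i <- s) x i
    & forall (s : seq I) (x : I -> V), uniq s -> (forall i, P i (x i)) ->
        \sum_(i <- s) x i = 0 -> forall i, i \in s -> x i = 0].

(* W is a Z/2-graded subspace for the grading par (true = odd). *)
Definition graded_sub (par : bool -> set V) (W : set V) : Prop :=
  linear_sub W /\
  forall v, W v -> exists v0 v1,
    [/\ par false v0, par true v1, W v0, W v1 & v = v0 + v1].

Lemma lspan_sub (X : set V) : linear_sub (lspan X).
Proof.
split=> [W [] //|a u v Xu Xv W WL XW].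
by apply: WL.2; [apply: Xu|apply: Xv].
Qed.

Lemma lspan_incl (X : set V) : X `<=` lspan X.
Proof. by move=> v Xv W _; apply. Qed.

Lemma lspanD (X : set V) u v : lspan X u -> lspan X v -> lspan X (u + v).
Proof. by move=> Xu Xv; rewrite -[u]scale1r; apply: (lspan_sub X).2. Qed.

Lemma linear_subD (W : set V) u v : linear_sub W -> W u -> W v -> W (u + v).
Proof. by move=> WL Wu Wv; rewrite -[u]scale1r; apply: WL.2. Qed.

Lemma linear_subZ (W : set V) a u : linear_sub W -> W u -> W (a *: u).
Proof. by move=> WL Wu; rewrite -[_ *: _]addr0; apply: WL.2 => //; case: WL. Qed.

End LinearAlgebra.

Lemma linear_raddf (F : fieldType) (V W : lmodType F) (f : V -> W) :
  linear f -> [/\ f 0 = 0, forall u v, f (u + v) = f u + f v,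
    forall a u, f (a *: u) = a *: f u & forall u, f (- u) = - f u].
Proof.
move=> fL.
have f0 : f 0 = 0 by have := fL (-1) 0 0; rewrite scaler0 addr0 scaleN1r addNr.
have fZ a u : f (a *: u) = a *: f u by rewrite -[_ *: u]addr0 fL f0 addr0.
split=> // [u v|u]; first by rewrite -[u]scale1r fL scale1r scale1r.
by rewrite -scaleN1r fZ scaleN1r.
Qed.

Lemma linear_ker (F : fieldType) (V W : lmodType F) (f : V -> W) :
  linear f -> linear_sub [set v | f v = 0].
Proof.
move=> fL; have [f0 _ _ _] := linear_raddf fL; split=> //= a u v fu fv.
by rewrite fL fu fv scaler0 addr0.
Qed.

Lemma linear_eq (F : fieldType) (V W : lmodType F) (f f' : V -> W) :
  linear f -> linear f' -> linear_sub [set v | f v = f' v].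
Proof.
move=> fL fL'; have [f0 _ _ _] := linear_raddf fL.
have [f'0 _ _ _] := linear_raddf fL'; split=> /=; first by rewrite f0 f'0.
by move=> a u v fu fv; rewrite fL fL' fu fv.
Qed.

(* The vector space with generators X and linear relations rel. *)
Section Presented.
Variables (F : fieldType) (X : choiceType) (rel : set {freeg X / F}).

Definition relations : {pred {freeg X / F}} := fun v => `[< lspan rel v >].

Lemma relations_zmod : zmod_closed relations.
Proof.
split=> [|u v]; first by apply/asboolP; case: (lspan_sub rel).
move=> /asboolP ru /asboolP rv; apply/asboolP.
by rewrite addrC -scaleN1r; apply: (lspan_sub rel).2.
Qed.
HB.instance Definition _ := GRing.isZmodClosed.Build _ relations relations_zmod.

Definition presented : Type := Quotient.quot relations.
HB.instance Definition _ := GRing.Zmodule.on presented.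

Definition pclass (v : {freeg X / F}) : presented := \pi_(Quotient.quot relations)%qT v.

Lemma pclassB u v : pclass (u - v) = pclass u - pclass v.
Proof. by rewrite /pclass (raddfB (\pi_(Quotient.quot relations)%qT)). Qed.

Lemma pclassD u v : pclass (u + v) = pclass u + pclass v.
Proof. by rewrite /pclass (raddfD (\pi_(Quotient.quot relations)%qT)). Qed.

Lemma pclass0 : pclass 0 = 0.
Proof. by rewrite -{1}(subrr 0) pclassB subrr. Qed.

Lemma pclass_eq u v : lspan rel (u - v) -> pclass u = pclass v.
Proof.
move=> ruv; apply/eqP; rewrite -Quotient.idealrBE.
by apply/asboolP.
Qed.

Lemma pclass_eqE u v : pclass u = pclass v -> lspan rel (u - v).
Proof. by move/eqP; rewrite -Quotient.idealrBE => /asboolP. Qed.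

Lemma pclass_surj q : exists v, q = pclass v.
Proof. by exists (repr q); rewrite /pclass reprK. Qed.

Definition pscale (a : F) (q : presented) : presented := pclass (a *: repr q).

Lemma pscaleE a v : pscale a (pclass v) = pclass (a *: v).
Proof.
apply: pclass_eq; rewrite -scalerBr; apply: (linear_subZ _ (lspan_sub rel)).
by apply: pclass_eqE; rewrite /pclass reprK.
Qed.

Lemma pscaleA a b q : pscale a (pscale b q) = pscale (a * b) q.
Proof. by have [v ->] := pclass_surj q; rewrite !pscaleE scalerA. Qed.
Lemma pscale1 : left_id 1 pscale.
Proof. by move=> q; have [v ->] := pclass_surj q; rewrite pscaleE scale1r. Qed.
Lemma pscaleDr : right_distributive pscale +%R.
Proof.
move=> a q q'; have [[v ->] [v' ->]] := (pclass_surj q, pclass_surj q').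
by rewrite -pclassD !pscaleE scalerDr pclassD.
Qed.
Lemma pscaleDl q : {morph pscale^~ q : a b / a + b}.
Proof.
move=> a b; have [v ->] := pclass_surj q.
by rewrite !pscaleE scalerDl pclassD.
Qed.
HB.instance Definition _ :=
  GRing.Zmodule_isLmodule.Build F presented pscaleA pscale1 pscaleDr pscaleDl.

Lemma pclassZ a v : pclass (a *: v) = a *: pclass v.
Proof. by rewrite -pscaleE. Qed.

Definition pgen (x : X) : presented := pclass << 1 *g x >>.

Definition plift (V : lmodType F) (f : X -> V) (q : presented) : V :=
  fglift f (repr q).

Lemma fglift_linear (V : lmodType F) (f : X -> V) : linear (fglift f).
Proof.
have liftA := @lift_is_additive F X V f.
have lift0 : fglift f 0 = 0 by rewrite -(subrr 0) liftA subrr.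
have liftN u : fglift f (- u) = - fglift f u.
  by rewrite -[- u]sub0r liftA lift0 sub0r.
have liftD u v : fglift f (u + v) = fglift f u + fglift f v.
  by rewrite -{1}[v]opprK liftA liftN opprK.
move=> a u v; rewrite liftD; congr (_ + _).
have lsum (I : Type) (r : seq I) G :
    fglift f (\sum_(i <- r) G i) = \sum_(i <- r) fglift f (G i).
  by elim/big_rec2: _ => // i ? ? _ <-; rewrite liftD.
have -> : fglift f u = \sum_(x <- dom u) coeff x u *: f x.
  by rewrite -{1}[u]freeg_sumE lsum; apply: eq_bigr => x _; rewrite liftU.
have -> : a *: u = \sum_(x <- dom u) << a * coeff x u *g x >> by [].
by rewrite lsum scaler_sumr; apply: eq_bigr => x _; rewrite liftU scalerA.
Qed.

Lemma pgen_ind (W : set presented) :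
  linear_sub W -> (forall x, W (pgen x)) -> forall q, W q.
Proof.
move=> WL Wg q; have [v ->] := pclass_surj q.
rewrite -[v]freeg_sumE; elim/big_rec: _ => [|x u _ Wu].
  by rewrite pclass0; case: WL.
rewrite pclassD; apply: linear_subD => //.
suff -> : << coeff x v *g x >> = coeff x v *: << 1 *g x >> :> {freeg X / F}.
  by rewrite pclassZ; apply: linear_subZ => //; apply: Wg.
by apply/eqP/freeg_eqP => y; rewrite coeffZ !coeffU mul1r.
Qed.

Lemma prel v : rel v -> pclass v = 0.
Proof.
by move=> rv; rewrite -pclass0; apply: pclass_eq; rewrite subr0; apply: lspan_incl.
Qed.

Lemma plift_class (V : lmodType F) (f : X -> V) v :
  (forall r, rel r -> fglift f r = 0) -> plift f (pclass v) = fglift f v.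
Proof.
move=> fr; have fL := fglift_linear f.
have [_ fD _ fN] := linear_raddf fL.
apply/subr0_eq; rewrite /plift -fN -fD.
have rv : lspan rel (repr (pclass v) - v) by apply: pclass_eqE; rewrite /pclass reprK.
exact: (rv _ (linear_ker fL) fr).
Qed.

Lemma plift_linear (V : lmodType F) (f : X -> V) :
  (forall r, rel r -> fglift f r = 0) -> linear (plift f).
Proof.
move=> fr a q q'; have [[v ->] [v' ->]] := (pclass_surj q, pclass_surj q').
by rewrite -pclassZ -pclassD !plift_class // fglift_linear.
Qed.

Lemma plift_gen (V : lmodType F) (f : X -> V) x :
  (forall r, rel r -> fglift f r = 0) -> plift f (pgen x) = f x.
Proof. by move=> fr; rewrite plift_class // liftU scale1r. Qed.

End Presented.

(* The characteristic is 0, so no extra axioms on [x, x] are needed. *)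
Record lieSuper (F : numFieldType) := LieSuper {
  ls_sort :> lmodType F;
  ls_par : bool -> set ls_sort;
  ls_br : ls_sort -> ls_sort -> ls_sort;
  ls_parP : grading ls_par;
  ls_brDl : forall z, linear (ls_br^~ z);
  ls_brDr : forall z, linear (ls_br z);
  ls_br_par : forall a b x y, ls_par a x -> ls_par b y ->
    ls_par (a (+) b) (ls_br x y);
  ls_brC : forall a b x y, ls_par a x -> ls_par b y ->
    ls_br x y = - ((-1) ^+ (a && b) *: ls_br y x);
  ls_brJ : forall a b x y z, ls_par a x -> ls_par b y ->
    ls_br x (ls_br y z) =
    ls_br (ls_br x y) z + (-1) ^+ (a && b) *: ls_br y (ls_br x z) }.

Definition ls_hom (F : numFieldType) (g g' : lieSuper F) (phi : g -> g') : Prop :=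
  [/\ linear phi, forall a x, ls_par a x -> ls_par a (phi x)
    & forall x y, phi (ls_br x y) = ls_br (phi x) (phi y)].

Record subalg (F : numFieldType) (g : lieSuper F) := Subalg {
  sa_set :> g -> Prop;
  sa_graded : graded_sub (@ls_par F g) sa_set;
  sa_br : forall x y, sa_set x -> sa_set y -> sa_set (ls_br x y) }.

Lemma grading2 (F : fieldType) (V : lmodType F) (P : bool -> set V) v :
  grading P -> exists v0 v1, [/\ P false v0, P true v1 & v = v0 + v1].
Proof.
case=> PL Pg _; have [s [x [Px ->]]] := Pg v.
elim: s => [|b s [v0 [v1 [Pv0 Pv1]]]].
  by exists 0, 0; rewrite big_nil addr0; split=> //; [case: (PL false)|case: (PL true)].
rewrite big_cons => ->; case: b.
  exists v0, (x true + v1); split=> //; last by rewrite addrCA.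
  exact: (linear_subD (PL true) (Px true)).
exists (x false + v0), v1; split=> //; last by rewrite addrA.
exact: (linear_subD (PL false) (Px false)).
Qed.

Lemma full_graded (F : numFieldType) (g : lieSuper F) :
  graded_sub (@ls_par F g) setT.
Proof.
split=> // v _; have [v0 [v1 [Pv0 Pv1 ->]]] := grading2 v (ls_parP g).
by exists v0, v1.
Qed.

Definition full (F : numFieldType) (g : lieSuper F) : subalg g :=
  @Subalg F g setT (full_graded g) (fun _ _ _ _ => I).

(* Z/2-graded modules over the subalgebra p; sm_act x is only meaningful for
   x in p. *)
Record smod (F : numFieldType) (g : lieSuper F) (p : subalg g) := SMod {
  sm_sort :> lmodType F;
  sm_par : bool -> set sm_sort;
  sm_act : g -> sm_sort -> sm_sort;
  sm_parP : grading sm_par;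
  sm_actDr : forall x, p x -> linear (sm_act x);
  sm_actDl : forall v a x y, p x -> p y ->
    sm_act (a *: x + y) v = a *: sm_act x v + sm_act y v;
  sm_act_par : forall a b x v, p x -> ls_par a x -> sm_par b v ->
    sm_par (a (+) b) (sm_act x v);
  sm_actM : forall a b x y v, p x -> p y -> ls_par a x -> ls_par b y ->
    sm_act (ls_br x y) v =
    sm_act x (sm_act y v) - (-1) ^+ (a && b) *: sm_act y (sm_act x v) }.

Section Modules.
Variables (F : numFieldType) (g : lieSuper F) (p : subalg g).

Definition smod_hom (M N : smod p) (phi : M -> N) : Prop :=
  [/\ linear phi, forall a v, sm_par a v -> sm_par a (phi v)
    & forall x v, p x -> phi (sm_act x v) = sm_act x (phi v)].

Definition submodule (M : smod p) (W : set M) : Prop :=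
  graded_sub (@sm_par F g p M) W /\
  forall x v, p x -> W v -> W (sm_act x v).

Definition simple (M : smod p) : Prop :=
  (exists v : M, v <> 0) /\
  forall W : set M, submodule W -> W = [set 0] \/ W = setT.

Definition simple_quotient (M N : smod p) : Prop :=
  simple N /\
  exists phi : M -> N, smod_hom phi /\ forall v, exists u, phi u = v.

End Modules.

Section Involution.
Variables (F : numFieldType) (V : lmodType F) (P : bool -> set V).

Lemma grading_invol : grading P ->
  exists sg : V -> V, linear sg /\ forall b v, P b v -> sg v = (-1) ^+ b *: v.
Proof.
move=> PG; have [PL _ Pi] := PG.
have uniq2 u0 u1 : P false u0 -> P true u1 -> u0 + u1 = 0 -> u0 = 0 /\ u1 = 0.
  move=> P0 P1 u01; pose x b := if b then u1 else u0.
  have xP b : P b (x b) by case: b.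
  have := Pi [:: false; true] x isT xP.
  rewrite !big_cons big_nil addr0 => /(_ u01) x0.
  by split; [exact: (x0 false)|exact: (x0 true)].
have /choice[d0 /choice[d1 dP]] := fun v => grading2 v PG.
have dE v u0 u1 : P false u0 -> P true u1 -> v = u0 + u1 ->
    d0 v = u0 /\ d1 v = u1.
  move=> P0 P1 vE; have [Pd0 Pd1 dE] := dP v.
  have [|||/subr0_eq -> /subr0_eq ->] // := uniq2 (d0 v - u0) (d1 v - u1).
  - by rewrite addrC -scaleN1r; apply: (PL _).2.
  - by rewrite addrC -scaleN1r; apply: (PL _).2.
  - by rewrite addrACA -opprD -vE -dE subrr.
exists (fun v => d0 v - d1 v); split=> [a u v|b v Pv].
  have [Pu0 Pu1 uE] := dP u; have [Pv0 Pv1 vE] := dP v.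
  have [||| -> ->] := dE (a *: u + v) (a *: d0 u + d0 v) (a *: d1 u + d1 v).
  - exact: (PL _).2.
  - exact: (PL _).2.
  - by rewrite addrACA -scalerDr -uE -vE.
  by rewrite scalerBr opprD addrACA.
have P0 c : P c 0 by case: (PL c).
case: b Pv => Pv; first have [||| -> ->] // := dE v 0 v.
- by rewrite add0r.
- by rewrite sub0r expr1 scaleN1r.
have [||| -> ->] // := dE v v 0; first by rewrite addr0.
by rewrite subr0 scale1r.
Qed.

Lemma invol_grading (sg : V -> V) :
    (forall b, linear_sub (P b)) ->
    (forall v, exists v0 v1, [/\ P false v0, P true v1 & v = v0 + v1]) ->
    linear sg -> (forall b v, P b v -> sg v = (-1) ^+ b *: v) ->
  grading P.
Proof.
move=> PL PD sgL sgP; split=> // [v|s x us xP x0 i si].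
  have [v0 [v1 [P0 P1 ->]]] := PD v.
  exists [:: false; true], (fun b => if b then v1 else v0).
  by rewrite !big_cons big_nil addr0; split=> //; case.
have [sg0 sgD _ _] := linear_raddf sgL.
have sgs : \sum_(i <- s) (-1) ^+ i *: x i = 0.
  have := congr1 sg x0; rewrite (big_morph sg sgD sg0) sg0; apply: etrans.
  by apply: eq_bigr => j _; rewrite (sgP j).
have two : (2 : F) != 0 by rewrite pnatr_eq0.
have : \sum_(j <- s) (1 + (-1) ^+ (i (+) j)) *: x j = 0.
  under eq_bigr do rewrite scalerDl scale1r signr_addb -scalerA.
  by rewrite big_split /= x0 -scaler_sumr sgs scaler0 addr0.
rewrite (bigD1_seq i) //= addbb expr0 big1 ?addr0 => [|j ji].
  by move/eqP; rewrite scaler_eq0 (negbTE two) => /eqP.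
have -> : i (+) j = true by move: ji; case: (i); case: (j).
by rewrite expr1 subrr scale0r.
Qed.

End Involution.

(* The universal enveloping algebra: words in g (the tensor algebra) modulo
   multilinearity and x y - (-1)^(|x||y|) y x = [x, y]. *)
Section Enveloping.
Variables (F : numFieldType) (g : lieSuper F).

Definition fgen (K : choiceType) (k : K) : {freeg K / F} := << 1 *g k >>.

Inductive env_rel : set {freeg (seq g) / F} :=
| EnvLin w1 w2 a x y :
    env_rel (fgen (w1 ++ (a *: x + y) :: w2)
             - (a *: fgen (w1 ++ x :: w2) + fgen (w1 ++ y :: w2)))
| EnvBr w1 w2 a b x y : ls_par a x -> ls_par b y ->
    env_rel (fgen (w1 ++ [:: x, y & w2])
             - ((-1) ^+ (a && b) *: fgen (w1 ++ [:: y, x & w2])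
                + fgen (w1 ++ ls_br x y :: w2))).

Definition envel : Type := presented env_rel.
HB.instance Definition _ := GRing.Lmodule.on envel.

Definition eword (w : seq g) : envel := pgen env_rel w.

Lemma ewordL w1 w2 a x y : eword (w1 ++ (a *: x + y) :: w2) =
  a *: eword (w1 ++ x :: w2) + eword (w1 ++ y :: w2).
Proof.
rewrite /eword /pgen -pclassZ -pclassD; apply/subr0_eq; rewrite -pclassB.
by apply: prel; apply: EnvLin.
Qed.

Lemma ewordB w1 w2 a b x y : ls_par a x -> ls_par b y ->
  eword (w1 ++ [:: x, y & w2]) =
  (-1) ^+ (a && b) *: eword (w1 ++ [:: y, x & w2]) + eword (w1 ++ ls_br x y :: w2).
Proof.
move=> Px Py; rewrite /eword /pgen -pclassZ -pclassD; apply/subr0_eq.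
by rewrite -pclassB; apply: prel; apply: EnvBr.
Qed.

Lemma env_lift (V : lmodType F) (f : seq g -> V) :
    (forall w1 w2 a x y, f (w1 ++ (a *: x + y) :: w2) =
       a *: f (w1 ++ x :: w2) + f (w1 ++ y :: w2)) ->
    (forall w1 w2 a b x y, ls_par a x -> ls_par b y ->
       f (w1 ++ [:: x, y & w2]) =
       (-1) ^+ (a && b) *: f (w1 ++ [:: y, x & w2]) + f (w1 ++ ls_br x y :: w2)) ->
  forall r, env_rel r -> fglift f r = 0.
Proof.
move=> fL fB r; have [_ fD fZ fN] := linear_raddf (fglift_linear f).
case=> [w1 w2 a x y|w1 w2 a b x y Px Py];
  rewrite !(fD, fN, fZ) !liftU !scale1r ?fL ?(fB _ _ _ _ _ _ Px Py);
  exact: subrr.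
Qed.

Definition emulw (w : seq g) : envel -> envel :=
  plift (fun w' => eword (w ++ w')).

Lemma emulw_rel w r :
  env_rel r -> fglift (fun w' => eword (w ++ w') : envel) r = 0.
Proof.
apply: env_lift => [w1 w2 a x y|w1 w2 a b x y Px Py]; rewrite !catA.
  exact: ewordL.
exact: ewordB.
Qed.

Lemma emulw_linear w : linear (emulw w).
Proof. exact: (plift_linear (@emulw_rel w)). Qed.

Lemma emulwE w w' : emulw w (eword w') = eword (w ++ w').
Proof. exact: (plift_gen _ (@emulw_rel w)). Qed.

Lemma eword_ind (W : set envel) :
  linear_sub W -> (forall w, W (eword w)) -> forall u, W u.
Proof. exact: pgen_ind. Qed.

Definition emul (u v : envel) : envel := plift (fun w => emulw w v) u.

Lemma emul_rel v r : env_rel r -> fglift (fun w => emulw w v) r = 0.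
Proof.
apply: env_lift => [w1 w2 a x y|w1 w2 a b x y Px Py].
  apply: (eword_ind (W := [set v | emulw (w1 ++ (a *: x + y) :: w2) v =
    a *: emulw (w1 ++ x :: w2) v + emulw (w1 ++ y :: w2) v])) v => [|w].
    apply: linear_eq => [|c u v]; first exact: emulw_linear.
    by rewrite !emulw_linear !scalerDr !scalerA [a * c]mulrC -!addrA;
       congr (_ + _); rewrite addrCA.
  by rewrite /= !emulwE -!catA /= ewordL.
apply: (eword_ind (W := [set v | emulw (w1 ++ [:: x, y & w2]) v =
  (-1) ^+ (a && b) *: emulw (w1 ++ [:: y, x & w2]) v
  + emulw (w1 ++ ls_br x y :: w2) v])) v => [|w].
  apply: linear_eq => [|c u v]; first exact: emulw_linear.
  by rewrite !emulw_linear !scalerDr !scalerA [_ * c]mulrC -!addrA;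
     congr (_ + _); rewrite addrCA.
by rewrite /= !emulwE -!catA /= (ewordB _ _ Px Py).
Qed.

Lemma emul_linear_l v : linear (emul^~ v).
Proof. exact: (plift_linear (@emul_rel v)). Qed.

Lemma emulE w v : emul (eword w) v = emulw w v.
Proof. exact: (plift_gen _ (@emul_rel v)). Qed.

Lemma emul_linear_r u : linear (emul u).
Proof.
move=> c v v'.
apply: (eword_ind (W := [set u | emul u (c *: v + v') =
  c *: emul u v + emul u v'])) u => [|w].
  apply: linear_eq => [|d u u']; first exact: emul_linear_l.
  by rewrite !emul_linear_l !scalerDr !scalerA [c * d]mulrC -!addrA;
     congr (_ + _); rewrite addrCA.
by rewrite /= !emulE emulw_linear.
Qed.

Lemma emulA : associative emul.
Proof.
move=> u v t.
apply: (eword_ind (W := [set u | emul u (emul v t) = emul (emul u v) t])) u.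
  apply: linear_eq => [|c u u']; first exact: emul_linear_l.
  by rewrite !emul_linear_l.
move=> w1 /=.
apply: (eword_ind (W := [set v | emul (eword w1) (emul v t) =
  emul (emul (eword w1) v) t])) v.
  apply: linear_eq => c u u'.
    by rewrite emul_linear_l emul_linear_r.
  by rewrite emul_linear_r emul_linear_l.
move=> w2 /=.
apply: (eword_ind (W := [set t | emul (eword w1) (emul (eword w2) t) =
  emul (emul (eword w1) (eword w2)) t])) t => [|w3].
  apply: linear_eq => [c u u'|]; last exact: emul_linear_r.
  by rewrite !emul_linear_r.
by rewrite /= !(emulE, emulwE) catA.
Qed.

Lemma emul1 : left_id (eword [::]) emul.
Proof.
apply: eword_ind => [|w]; last by rewrite emulE emulwE.
by apply: linear_eq => //; exact: emul_linear_r.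
Qed.

Lemma emulr1 : right_id (eword [::]) emul.
Proof.
apply: eword_ind => [|w]; last by rewrite emulE emulwE cats0.
by apply: linear_eq => //; exact: emul_linear_l.
Qed.

Lemma emulDl : left_distributive emul +%R.
Proof. by move=> u v t; case: (linear_raddf (emul_linear_l t)). Qed.

Lemma emulDr : right_distributive emul +%R.
Proof. by move=> u v t; case: (linear_raddf (emul_linear_r u)). Qed.

HB.instance Definition _ := GRing.Zmodule_isPzRing.Build envel
  emulA emul1 emulr1 emulDl emulDr.

Definition einj (x : g) : envel := eword [:: x].

Lemma emul_linearl (v : envel) : linear (fun u : envel => u * v).
Proof. exact: emul_linear_l. Qed.

Lemma emul_linearr (u : envel) : linear (fun v : envel => u * v).
Proof. exact: emul_linear_r. Qed.

Lemma ewordM w w' : eword w * eword w' = eword (w ++ w').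
Proof. by rewrite -[LHS]/(emul _ _) emulE emulwE. Qed.

Lemma einj_linear : linear einj.
Proof. by move=> a x y; rewrite /einj (ewordL [::] [::]). Qed.

Lemma einj_br a b x y : ls_par a x -> ls_par b y ->
  einj (ls_br x y) = einj x * einj y - (-1) ^+ (a && b) *: (einj y * einj x).
Proof.
move=> Px Py; rewrite /einj !ewordM /= (ewordB [::] [::] Px Py) /=.
by rewrite addrC addKr.
Qed.

Fixpoint hom_word (b : bool) (w : seq g) : Prop :=
  if w is x :: w' then exists a, ls_par a x /\ hom_word (a (+) b) w' else ~~ b.

Definition env_par (b : bool) : set envel := lspan [set eword w | w in hom_word b].

End Enveloping.

Section EnvelopingParity.
Variables (F : numFieldType) (g : lieSuper F).
Local Notation U := (envel g).

Lemma eword_cat_ind (T : set U) w1 w2 : linear_sub T ->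
  (forall b w, hom_word b w -> T (eword (w1 ++ w))) -> T (eword (w1 ++ w2)).
Proof.
move=> TL; elim: w2 w1 => [|x w2 IH] w1 Tw; first exact: (Tw false).
have [x0 [x1 [P0 P1 ->]]] := grading2 x (ls_parP g).
rewrite -[x0]scale1r ewordL; apply: TL.2; rewrite -cat_rcons.
  apply: IH => b w bw; rewrite cat_rcons; apply: (Tw b).
  by exists false.
apply: IH => b w bw; rewrite cat_rcons; apply: (Tw (~~ b)).
by exists true; rewrite /= negbK.
Qed.

Lemma env_hom_ind (T : set U) : linear_sub T ->
  (forall b u, env_par b u -> T u) -> forall u, T u.
Proof.
move=> TL Tp; apply: eword_ind => // w.
apply: (@eword_cat_ind _ [::]) => // b w' bw'.
by apply: (Tp b); apply: lspan_incl; exists w'.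
Qed.

Lemma env_invol : exists sg : U -> U,
  [/\ linear sg, forall b u, env_par b u -> sg u = (-1) ^+ b *: u
    & forall a u x, ls_par a x -> sg (u * einj x) = (-1) ^+ a *: (sg u * einj x)].
Proof.
have [s [sL sP]] := grading_invol (ls_parP g).
have [s0 sD sZ sN] := linear_raddf sL.
have rel r : env_rel r -> fglift (fun w => eword (map s w) : U) r = 0.
  apply: env_lift => [w1 w2 a x y|w1 w2 a b x y Px Py].
    by rewrite !map_cat /= sL ewordL.
  rewrite !map_cat /= (sP _ _ Px) (sP _ _ Py) (sP _ _ (ls_br_par Px Py)).
  have Q c (x' : g) : ls_par c x' -> forall d : nat, ls_par c ((-1) ^+ d *: x').
    move=> Px' d; have [PL _ _] := ls_parP g.
    exact: (linear_subZ _ (PL c)).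
  rewrite (ewordB _ _ (Q _ _ Px a) (Q _ _ Py b)); congr (_ + eword (_ ++ _ :: _)).
  have [_ _ bZl _] := linear_raddf (ls_brDl ((-1) ^+ b *: y)).
  have [_ _ bZr _] := linear_raddf (ls_brDr x).
  by rewrite bZl bZr scalerA signr_addb.
pose sg : U -> U := plift (fun w => eword (map s w)).
have sgL : linear sg := plift_linear rel.
have sgE w : sg (eword w) = eword (map s w) := plift_gen _ rel.
exists sg; split=> // [b u Pu|a u x Px].
  have [_ _ sgZ _] := linear_raddf sgL.
  apply: (Pu [set u | sg u = (-1) ^+ b *: u]).
    apply: linear_eq => // c v v'.
    by rewrite scalerDr !scalerA mulrC.
  move=> _ [w bw <-] /=; rewrite sgE; clear Pu u.
  elim: w b bw => [|x w IH] b /= bw; first by case: b bw => // _; rewrite scale1r.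
  case: bw => a [Px /IH wE].
  rewrite -[s x :: _]/([:: s x] ++ map s w) -ewordM wE (sP _ _ Px).
  have [_ _ iZ _] := linear_raddf (@einj_linear _ g).
  have [_ _ mZ _] := linear_raddf (emul_linearl ((-1) ^+ (a (+) b) *: eword w)).
  have [_ _ mZr _] := linear_raddf (emul_linearr (einj x)).
  rewrite -[eword [:: _]]/(einj _) iZ mZ mZr ewordM scalerA -signr_addb addbA addbb.
  by rewrite addFb.
apply: (eword_ind (W := [set u | sg (u * einj x) =
  (-1) ^+ a *: (sg u * einj x)])) u => [|w].
  apply: linear_eq => c v v'; first by rewrite emul_linearl sgL.
  by rewrite sgL emul_linearl scalerDr !scalerA mulrC.
rewrite /= ewordM !sgE map_cat /= (sP _ _ Px).
have [_ _ iZ _] := linear_raddf (@einj_linear _ g).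
have [_ _ mZ _] := linear_raddf (emul_linearr (eword (map s w))).
by rewrite -ewordM -[eword [:: _]]/(einj _) iZ mZ.
Qed.

Lemma env_parM a b (x : g) (u : U) :
  ls_par a x -> env_par b u -> env_par (a (+) b) (einj x * u).
Proof.
move=> Px Pu W WL WP.
apply: (Pu [set u | W (einj x * u)]) => [|_ [w bw <-]] /=.
  have [m0 _ _ _] := linear_raddf (emul_linearr (einj x)).
  split=> /= [|c v v' Wv Wv']; first by rewrite m0; case: WL.
  by rewrite emul_linearr; apply: WL.2.
rewrite ewordM; apply: WP; exists (x :: w) => //=.
by exists a; rewrite addbA addbb addFb.
Qed.

End EnvelopingParity.

(* Ind_p^g S = U(g) (x)_{U(p)} S.  Since U(p) is generated by p, balancing over
   p is balancing over U(p). *)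
Section Induction.
Variables (F : numFieldType) (g : lieSuper F) (p : subalg g) (S : smod p).
Local Notation U := (envel g).

Inductive ind_rel : set {freeg (U * S) / F} :=
| IndDl a (u u' : U) (s : S) :
    ind_rel (fgen F (a *: u + u', s) - (a *: fgen F (u, s) + fgen F (u', s)))
| IndDr a (u : U) (s s' : S) :
    ind_rel (fgen F (u, a *: s + s') - (a *: fgen F (u, s) + fgen F (u, s')))
| IndBal (u : U) x (s : S) : p x ->
    ind_rel (fgen F (u * einj x, s) - fgen F (u, sm_act x s)).

Definition ind_space : Type := presented ind_rel.
HB.instance Definition _ := GRing.Lmodule.on ind_space.

Definition tens (u : U) (s : S) : ind_space := pgen ind_rel (u, s).

Lemma tens_linearl s : linear (tens^~ s).
Proof.
move=> a u u'; rewrite /tens /pgen -pclassZ -pclassD; apply/subr0_eq.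
by rewrite -pclassB; apply: prel; apply: IndDl.
Qed.

Lemma tens_linearr u : linear (tens u).
Proof.
move=> a s s'; rewrite /tens /pgen -pclassZ -pclassD; apply/subr0_eq.
by rewrite -pclassB; apply: prel; apply: IndDr.
Qed.

Lemma tens_bal u x s : p x -> tens (u * einj x) s = tens u (sm_act x s).
Proof.
move=> px; apply/subr0_eq; rewrite /tens /pgen -pclassB.
by apply: prel; apply: IndBal.
Qed.

Lemma tens_ind (W : set ind_space) :
  linear_sub W -> (forall u s, W (tens u s)) -> forall q, W q.
Proof. by move=> WL Wt; apply: pgen_ind => // -[u s]; apply: Wt. Qed.

Lemma ind_lift (V : lmodType F) (f : U -> S -> V) :
    (forall s, linear (f^~ s)) -> (forall u, linear (f u)) ->
    (forall u x s, p x -> f (u * einj x) s = f u (sm_act x s)) ->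
  forall r, ind_rel r -> fglift (fun us => f us.1 us.2) r = 0.
Proof.
move=> fl fr fb r.
have [_ fD fZ fN] := linear_raddf (fglift_linear (fun us : U * S => f us.1 us.2)).
case=> [a u u' s|a u s s'|u x s px];
  rewrite !(fD, fN, fZ) !liftU !scale1r /= ?fl ?fr ?(fb _ _ _ px);
  exact: subrr.
Qed.

Definition ind_act (x : g) : ind_space -> ind_space :=
  plift (fun us : U * S => tens (einj x * us.1) us.2).

Lemma ind_act_rel x r : ind_rel r ->
  fglift (fun us : U * S => tens (einj x * us.1) us.2) r = 0.
Proof.
apply: (ind_lift (f := fun u s => tens (einj x * u) s)) => [s a u u'|u a s s'|u y s py].
- by rewrite emul_linearr tens_linearl.
- exact: tens_linearr.
- by rewrite mulrA tens_bal.
Qed.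

Lemma ind_act_linear x : linear (ind_act x).
Proof. exact: (plift_linear (@ind_act_rel x)). Qed.

Lemma ind_actE x u s : ind_act x (tens u s) = tens (einj x * u) s.
Proof. exact: (plift_gen _ (@ind_act_rel x)). Qed.

Lemma ind_actDl v a x y :
  ind_act (a *: x + y) v = a *: ind_act x v + ind_act y v.
Proof.
apply: (tens_ind (W := [set v | ind_act (a *: x + y) v =
  a *: ind_act x v + ind_act y v])) v => [|u s].
  apply: linear_eq => [|c v v']; first exact: ind_act_linear.
  by rewrite !ind_act_linear !scalerDr !scalerA [a * c]mulrC -!addrA;
     congr (_ + _); rewrite addrCA.
by rewrite /= !ind_actE einj_linear emul_linearl tens_linearl.
Qed.

Lemma ind_actM a b x y v : ls_par a x -> ls_par b y ->
  ind_act (ls_br x y) v =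
  ind_act x (ind_act y v) - (-1) ^+ (a && b) *: ind_act y (ind_act x v).
Proof.
move=> Px Py.
apply: (tens_ind (W := [set v | ind_act (ls_br x y) v =
  ind_act x (ind_act y v) - (-1) ^+ (a && b) *: ind_act y (ind_act x v)])) v.
  apply: linear_eq => [|c v v']; first exact: ind_act_linear.
  rewrite !ind_act_linear scalerBr !scalerDr !scalerA [c * _]mulrC opprD.
  by rewrite addrACA.
move=> u s; rewrite /= !ind_actE (einj_br Px Py) mulrBl.
have [_ tD tZ tN] := linear_raddf (tens_linearl s).
have [_ _ mZ _] := linear_raddf (emul_linearl u).
by rewrite tD tN mZ tZ !mulrA.
Qed.

Definition ind_par (b : bool) : set ind_space :=
  lspan [set q | exists a c u s,
    [/\ a (+) c = b, env_par a u, sm_par c s & q = tens u s]].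

Lemma ind_parP : grading ind_par.
Proof.
have [sU [sUL sUP sUM]] := env_invol g.
have [sS [sSL sSP]] := grading_invol (sm_parP S).
have rel r : ind_rel r -> fglift (fun us : U * S => tens (sU us.1) (sS us.2)) r = 0.
  apply: (ind_lift (f := fun u s => tens (sU u) (sS s))).
  - by move=> s a u u'; rewrite sUL tens_linearl.
  - by move=> u a s s'; rewrite sSL tens_linearr.
  have hom a u x s : ls_par a x -> p x ->
      tens (sU (u * einj x)) (sS s) = tens (sU u) (sS (sm_act x s)).
    move=> Px px; rewrite (sUM _ _ _ Px).
    have [_ _ tZ _] := linear_raddf (tens_linearl (sS s)).
    rewrite tZ (tens_bal _ _ px).
    have [_ _ tZr _] := linear_raddf (tens_linearr (sU u)).
    rewrite -tZr; congr tens.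
    have [s0 [s1 [P0 P1 ->]]] := grading2 s (sm_parP S).
    have [_ aD aZ _] := linear_raddf (@sm_actDr _ _ _ S _ px).
    have [_ sD _ _] := linear_raddf sSL.
    rewrite !(sD, aD) (sSP _ _ P0) (sSP _ _ P1) !aZ scalerDr !scalerA -!signr_addb.
    by rewrite (sSP _ _ (sm_act_par px Px P0)) (sSP _ _ (sm_act_par px Px P1)).
  move=> u x s px; have [_ /(_ x px) [x0 [x1 [P0 P1 p0 p1 ->]]]] := sa_graded p.
  rewrite -[x0]scale1r einj_linear (sm_actDl _ _ p0 p1) emul_linearr sUL sSL.
  by rewrite tens_linearl tens_linearr (hom _ _ _ _ P0 p0) (hom _ _ _ _ P1 p1).
pose sg : ind_space -> ind_space :=
  plift (fun us : U * S => tens (sU us.1) (sS us.2)).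
have sgL : linear sg := plift_linear rel.
have sgE u s : sg (tens u s) = tens (sU u) (sS s) := plift_gen _ rel.
apply: (invol_grading _ _ sgL) => [b|v|b v Pv]; first exact: lspan_sub.
  apply: (tens_ind (W := [set v | exists v0 v1,
    [/\ ind_par false v0, ind_par true v1 & v = v0 + v1]])) v => [|u s].
    split=> [|c _ _ [v0 [v1 [P0 P1 ->]]] [w0 [w1 [Q0 Q1 ->]]]] /=.
      exists 0, 0; split; [exact: (lspan_sub _).1|exact: (lspan_sub _).1|].
      by rewrite addr0.
    exists (c *: v0 + w0), (c *: v1 + w1).
    split; [exact: (lspan_sub _).2|exact: (lspan_sub _).2|].
    by rewrite scalerDr addrACA.
  apply: (env_hom_ind (T := [set u | exists v0 v1,
    [/\ ind_par false v0, ind_par true v1 & tens u s = v0 + v1]])) u => [|a u Pu].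
    split=> [|c u u' [v0 [v1 [P0 P1 vE]]] [w0 [w1 [Q0 Q1 wE]]]] /=.
      exists 0, 0; split; [exact: (lspan_sub _).1|exact: (lspan_sub _).1|].
      by have [-> _ _ _] := linear_raddf (tens_linearl s); rewrite addr0.
    exists (c *: v0 + w0), (c *: v1 + w1).
    split; [exact: (lspan_sub _).2|exact: (lspan_sub _).2|].
    by rewrite tens_linearl vE wE scalerDr addrACA.
  have [s0 [s1 [P0 P1 ->]]] := grading2 s (sm_parP S).
  have [_ tD _ _] := linear_raddf (tens_linearr u); rewrite /= tD.
  have T0 : ind_par (a (+) false) (tens u s0).
    by apply: lspan_incl; exists a, false, u, s0.
  have T1 : ind_par (a (+) true) (tens u s1).
    by apply: lspan_incl; exists a, true, u, s1.
  case: a {Pu} T0 T1 => T0 T1.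
    by exists (tens u s1), (tens u s0); rewrite addrC.
  by exists (tens u s0), (tens u s1).
apply: (Pv [set v | sg v = (-1) ^+ b *: v]).
  by apply: linear_eq => // c w w'; rewrite scalerDr !scalerA mulrC.
move=> _ [a [c [u [s [<- Pu Ps ->]]]]] /=.
have [_ _ tZ _] := linear_raddf (tens_linearl ((-1) ^+ c *: s)).
have [_ _ tZr _] := linear_raddf (tens_linearr u).
by rewrite sgE (sUP _ _ Pu) (sSP _ _ Ps) tZ tZr scalerA signr_addb.
Qed.

Lemma ind_act_par a b x v :
  ls_par a x -> ind_par b v -> ind_par (a (+) b) (ind_act x v).
Proof.
move=> Px Pv W WL WP.
apply: (Pv [set v | W (ind_act x v)]) => /=.
  have [m0 _ _ _] := linear_raddf (ind_act_linear x).
  split=> /= [|c u u' Wu Wu']; first by rewrite m0; case: WL.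
  by rewrite ind_act_linear; apply: WL.2.
move=> _ [a' [c [u [s [abE Pu Ps ->]]]]] /=; rewrite ind_actE.
apply: WP; exists (a (+) a'), c, (einj x * u), s.
by split=> //; [rewrite -abE addbA|exact: env_parM].
Qed.

Definition Ind : smod (full g) :=
  @SMod F g (full g) ind_space ind_par ind_act ind_parP
    (fun x _ => ind_act_linear x) (fun v a x y _ _ => ind_actDl v a x y)
    (fun a b x v _ => @ind_act_par a b x v)
    (fun a b x y v _ _ => @ind_actM a b x y v).

End Induction.

(* Contragredient Lie superalgebras all of whose simple roots are odd. *)
Section Contragredient.
Variables (F : numFieldType) (n : nat) (A : 'M[F]_n).

Definition chevalley_relations (g : lieSuper F) (e f h : 'I_n -> g) : Prop :=
  [/\ forall i, [/\ ls_par true (e i), ls_par true (f i) & ls_par false (h i)],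
      forall i j, ls_br (h i) (h j) = 0,
      forall i j, ls_br (e i) (f j) = if i == j then h i else 0,
      forall i j, ls_br (h i) (e j) = A i j *: e j
    & forall i j, ls_br (h i) (f j) = - (A i j *: f j)].

Definition generated (g : lieSuper F) (e f h : 'I_n -> g) : Prop :=
  forall W : set g, linear_sub W ->
    (forall x y, W x -> W y -> W (ls_br x y)) ->
    (forall i, [/\ W (e i), W (f i) & W (h i)]) -> forall x, W x.

(* Universal property of the presentation by generators and relations. *)
Definition chevalley_presented (g : lieSuper F) (e f h : 'I_n -> g) : Prop :=
  [/\ chevalley_relations e f h, generated e f h
    & forall (g' : lieSuper F) (e' f' h' : 'I_n -> g'),
        chevalley_relations e' f' h' ->
        exists phi : g -> g', ls_hom phi /\
          forall i, [/\ phi (e i) = e' i, phi (f i) = f' i & phi (h i) = h' i]].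

Definition ideal (g : lieSuper F) (J : set g) : Prop :=
  graded_sub (@ls_par F g) J /\ forall x y, J y -> J (ls_br x y).

Definition cartan (g : lieSuper F) (h : 'I_n -> g) : set g := lspan (range h).

Definition meets_trivially (g : lieSuper F) (J H : set g) : Prop :=
  J `&` H = [set 0].

(* g = g(A): the quotient of the presented algebra gt by its largest ideal
   (the kernel of pi) intersecting the Cartan subalgebra trivially. *)
Definition contragredient (g : lieSuper F) (e f h : 'I_n -> g) : Prop :=
  lin_indep h /\
  exists (gt : lieSuper F) (et ft ht : 'I_n -> gt) (pi : gt -> g),
    [/\ chevalley_presented et ft ht,
        ls_hom pi /\ (forall x, exists y, pi y = x),
        forall i, [/\ pi (et i) = e i, pi (ft i) = f i & pi (ht i) = h i],
        meets_trivially [set y | pi y = 0] (cartan ht)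
      & forall J : set gt, ideal J -> meets_trivially J (cartan ht) ->
          J `<=` [set y | pi y = 0]].

End Contragredient.

(* The h i are a basis of the Cartan subalgebra, so mu in its dual is encoded
   by the row vector of the values mu (h i). *)
Section Cuspidal.
Variables (F : numFieldType) (n : nat) (g : lieSuper F) (h : 'I_n -> g).

Definition weight_space (p : subalg g) (M : smod p) (mu : 'rV[F]_n) : set M :=
  [set m | forall i, sm_act (h i) m = mu 0 i *: m].
Arguments weight_space {p} M mu _.

Definition weight_module (p : subalg g) (M : smod p) : Prop :=
  grading (weight_space M).

Definition finite_weight_module (p : subalg g) (M : smod p) : Prop :=
  weight_module M /\ forall mu, exists d, has_dim (weight_space M mu) d.

Definition Z_grading (gr : int -> set g) : Prop :=
  [/\ grading gr, forall j, graded_sub (@ls_par F g) (gr j),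
      forall i j x y, gr i x -> gr j y -> gr (i + j) (ls_br x y)
    & cartan h `<=` gr 0].

Definition parabolic (p : subalg g) : Prop :=
  exists gr : int -> set g, Z_grading gr /\
    forall x, p x <-> lspan [set y | exists2 j, 0 <= j & gr j y] x.

(* M is isomorphic to L_p(S) for some simple weight p-module S: L_p(S) being the
   only simple quotient of Ind_p^g S, this means that M is such a quotient. *)
Definition parabolically_induced (p : subalg g) (M : smod (full g)) : Prop :=
  exists S : smod p,
    [/\ simple S, weight_module S & simple_quotient (Ind S) M].

Definition cuspidal (M : smod (full g)) : Prop :=
  [/\ simple M, finite_weight_module M
    & forall p : subalg g, parabolic p -> (exists x, ~ p x) ->
        ~ parabolically_induced p M].

End Cuspidal.
Arguments weight_space {F n g} h {p} M mu _.

Section D21.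
Variables (F : numFieldType) (alpha : F).

Definition D21_cartan : 'M[F]_3 :=
  \matrix_(i, j)
    (nth [::] [:: [:: 0;     1;           alpha      ];
                  [:: 1;     0;           - alpha - 1];
                  [:: alpha; - alpha - 1; 0          ]] i)`_j.

(* beta_j (h_i) = a_ij *)
Definition D21_root (j : 'I_3) : 'rV[F]_3 := \row_i D21_cartan i j.

Definition D21_even_lattice : set 'rV[F]_3 :=
  [set v | exists k1 k2 k3 : int,
     v = (D21_root 0 + D21_root 1) *~ k1 + (D21_root 0 + D21_root 2) *~ k2
         + (D21_root 1 + D21_root 2) *~ k3].

End D21.

(* Main.v *)
(** Every even root vector of [g] acts injectively on a cuspidal module [M];
    applied to a root and to its opposite, this gives injections between the
    weight spaces [M_mu] and [M_(mu + gamma)] in both directions, hence the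
    equality of dimensions.

    For the injectivity, suppose that [x = [e_i, e_j]] has a nonzero kernel [K] on
    [M].  Let [H] in the Cartan subalgebra have degrees 1, 1, -1 on
    [e_i, e_j, e_k].  The positive part of the resulting grading of [g] is spanned
    by [x], which has degree 2 and is central in it, and by four odd elements of
    degree 1 whose mutual brackets are multiples of [x].  These preserve [K] and
    anticommute on it, so that some nonzero eigenvector of [H] in [K] is killed by
    the whole positive part.  The top eigenspace of [H] is then a simple module
    over the nonnegative part of [g], from which [M] is parabolically induced. *)

From HB Require Import structures.
Require Import Defs.
From mathcomp Require Import all_boot all_order all_algebra.
From mathcomp Require Import boolp classical_sets reals complex freeg ring.

Set Implicit Arguments.
Unset Strict Implicit.
Unset Printing Implicit Defensive.

Import Order.TTheory GRing.Theory Num.Theory.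
Local Open Scope classical_set_scope.
Local Open Scope ring_scope.

(** * Linear algebra *)

(** The argument needs every root vector of positive degree, but [g] is given only as a quotient by
    a maximal ideal. Its relations are therefore drawn from maximality: an element of positive
    principal degree annihilated by all [f j] generates an ideal avoiding the Cartan subalgebra, so
    it is zero. This yields [e_i, e_i] = 0 and the proportionality of the triple brackets, which
    rests on a_12 + a_13 + a_23 = 0; together they kill all brackets of four [e], and an explicit
    spanning set of [g] results. Exchanging [e] and [f] negates the matrix, which transfers every
    statement to the [f] and to the opposite root.

    With degrees 1, 1, -1 the triple bracket has degree 1 instead of 3, and beta_i + beta_j is the
    only root of degree 2 or more. An [H] with these degrees exists because the Cartan matrix is
    invertible, with determinant -2 alpha (alpha + 1). Parabolic induction is established by a
    nonzero map from the induced module to the simple module M. *)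

Section LinearSubspaces.
Variables (F : fieldType) (V : lmodType F).
Implicit Types (W X : set V).

Lemma linear_sub_sum (I : Type) (r : seq I) (P : pred I) W (G : I -> V) :
  linear_sub W -> (forall i, P i -> W (G i)) -> W (\sum_(i <- r | P i) G i).
Proof.
by move=> WL WG; elim/big_rec: _ => [|i u Pi Wu]; [case: WL|apply: linear_subD; auto].
Qed.

Lemma linear_subN W u : linear_sub W -> W u -> W (- u).
Proof. by move=> WL Wu; rewrite -scaleN1r; apply: linear_subZ. Qed.

Lemma linear_subB W u v : linear_sub W -> W u -> W v -> W (u - v).
Proof. by move=> WL Wu Wv; apply: linear_subD => //; apply: linear_subN. Qed.

Lemma lspan_range n (b : 'I_n -> V) v :
  lspan (range b) v -> exists c : 'I_n -> F, v = \sum_i c i *: b i.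
Proof.
move=> bv; apply: (bv [set v | exists c : 'I_n -> F, v = \sum_i c i *: b i]).
  split=> [|a _ _ [c ->] [c' ->]] /=.
    by exists (fun=> 0); rewrite big1 // => i _; rewrite scale0r.
  exists (fun i => a * c i + c' i); rewrite scaler_sumr -big_split /=.
  by apply: eq_bigr => i _; rewrite scalerDl scalerA.
move=> _ [i _ <-]; exists (fun j => (j == i)%:R).
rewrite (bigD1 i) //= eqxx scale1r big1 ?addr0 // => j /negbTE ->.
by rewrite scale0r.
Qed.

(** The list supplied by [grading] may repeat an index, while its independence clause wants a [uniq]
    list; repeated components are merged by their multiplicity. *)
Lemma grading_uniq (I : choiceType) (P : I -> set V) v :
  grading P -> exists s x, [/\ uniq s, forall i, P i (x i) & v = \sum_(i <- s) x i].
Proof.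
case=> PL PD _; have [s [x [Px ->]]] := PD v.
exists (undup s), (fun i => x i *+ count_mem i s); split=> [|i|].
- exact: undup_uniq.
- by rewrite -scaler_nat; apply: linear_subZ.
by rewrite -big_undup_iterop_count.
Qed.

End LinearSubspaces.

Lemma linear_sum (F : fieldType) (V W : lmodType F) (f : V -> W) (I : Type)
    (r : seq I) (P : pred I) (G : I -> V) :
  linear f -> f (\sum_(i <- r | P i) G i) = \sum_(i <- r | P i) f (G i).
Proof. by move=> fL; have [f0 fD _ _] := linear_raddf fL; apply: big_morph. Qed.

(** If d2 < d1, the matrix of [f] on the two bases has more rows than columns, and a nonzero row in
    its kernel is a linear relation on the basis of [W1]. *)
Lemma has_dim_le (F : fieldType) (V1 V2 : lmodType F) (f : V1 -> V2)
    (W1 : set V1) (W2 : set V2) d1 d2 :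
    linear f -> (forall v, W1 v -> W2 (f v)) ->
    (forall v, W1 v -> f v = 0 -> v = 0) ->
  has_dim W1 d1 -> has_dim W2 d2 -> (d1 <= d2)%N.
Proof.
move=> fL f12 f0 [b1 [b1I b1W]] [b2 [b2I b2W]].
have Wb1 i : W1 (b1 i) by rewrite -b1W; apply: lspan_incl; exists i.
have /choice[C CE] i : exists c : 'I_d2 -> F, f (b1 i) = \sum_j c j *: b2 j.
  by apply: lspan_range; rewrite b2W; apply: f12.
pose A := \matrix_(i, j) C i j.
rewrite leqNgt; apply/negP => d21.
have /rowV0Pn[r /sub_kermxP rA r0] : kermx A != 0.
  by rewrite kermx_eq0 /row_free neq_ltn (leq_ltn_trans (rank_leq_col A)).
case/eqP: r0; apply/rowP => i; rewrite mxE.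
apply: (b1I (r 0) _ i); apply: f0.
  rewrite -b1W; apply: (linear_sub_sum _ (lspan_sub _)) => j _.
  by apply: (linear_subZ _ (lspan_sub _)); apply: lspan_incl; exists j.
have [_ _ fZ _] := linear_raddf fL.
rewrite (linear_sum _ _ _ fL); under eq_bigr do rewrite fZ CE scaler_sumr.
rewrite exchange_big big1 //= => j _; under eq_bigr do rewrite scalerA.
have /rowP/(_ j) := rA; rewrite !mxE -scaler_suml => rA0.
suff -> : \sum_k r 0 k * C k j = 0 by rewrite scale0r.
by rewrite -[RHS]rA0; apply: eq_bigr => k _; rewrite mxE.
Qed.

Lemma has_dim_uniq (F : fieldType) (V : lmodType F) (W : set V) d1 d2 :
  has_dim W d1 -> has_dim W d2 -> d1 = d2.
Proof.
have idL : linear (@id V) by [].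
move=> W1 W2; apply/eqP; rewrite eqn_leq.
by rewrite (has_dim_le idL _ _ W1 W2) // (has_dim_le idL _ _ W2 W1).
Qed.

(** * Eigenspaces of a linear map in arbitrary dimension *)

Section Eigenspaces.
Variables (F : fieldType) (V : lmodType F) (T : V -> V).
Hypothesis TL : linear T.

Definition eigsp (c : F) : set V := [set v | T v = c *: v].

Lemma eigsp_sub c : linear_sub (eigsp c).
Proof. by apply: linear_eq => // a u v; rewrite scalerDr !scalerA mulrC. Qed.

Let shift a v := T v - a *: v.
Local Notation shifts s := (fun v => foldr shift v s).

Let shift_linear a : linear (shift a).
Proof.
move=> b u v; rewrite /shift TL scalerDr scalerBr !scalerA mulrC opprD.
by rewrite addrACA.
Qed.

Let shiftC a b v : shift a (shift b v) = shift b (shift a v).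
Proof.
have [_ TD TZ TN] := linear_raddf TL.
rewrite /shift !TD !TN !TZ !scalerBr !opprB !scalerA [a * b]mulrC.
by rewrite -!addrA; congr (_ + _); rewrite addrCA [RHS]addrCA [in RHS](addrC (- _)).
Qed.

Let shifts_linear s : linear (shifts s).
Proof. by elim: s => //= b s IH a u v; rewrite IH shift_linear. Qed.

Let shiftsC a s v : shifts s (shift a v) = shift a (shifts s v).
Proof. by elim: s => //= b s ->; rewrite shiftC. Qed.

Let shifts_cat s1 s2 v : shifts (s1 ++ s2) v = shifts s2 (shifts s1 v).
Proof. by elim: s1 => //= a s1 ->; rewrite shiftsC. Qed.

(* The components of v away from the eigenvalue c are annihilated by a product
   of factors T - a with a <> c, which is injective on the eigenspace of c. *)
Lemma eigsp_lspan (X : set V) c v :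
    (forall x, X x -> exists d, eigsp d x) ->
  lspan X v -> eigsp c v -> lspan (X `&` eigsp c) v.
Proof.
move=> XE Xv vE.
have [u [w [s [Xu cs s0 vuw]]]] : exists u w s,
    [/\ lspan (X `&` eigsp c) u, c \notin s, shifts s w = 0 & v = u + w].
  apply: (Xv [set v | exists u w s,
    [/\ lspan (X `&` eigsp c) u, c \notin s, shifts s w = 0 & v = u + w]]).
    split=> [|a _ _ [u [w [s [Xu cs s0 ->]]]] [u' [w' [s' [Xu' cs' s'0 ->]]]]] /=.
      by exists 0, 0, [::]; rewrite addr0; split=> //; case: (lspan_sub (X `&` eigsp c)).
    exists (a *: u + u'), (a *: w + w'), (s ++ s'); split.
    - exact: (lspan_sub _).2.
    - by rewrite mem_cat negb_or cs.
    - have [y _ _ _] := linear_raddf (shifts_linear s).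
      rewrite shifts_cat shifts_linear s0 scaler0 add0r -shifts_cat.
      by rewrite foldr_cat s'0 y.
    by rewrite scalerDr addrACA.
  move=> x Xx; have [d xd] := XE x Xx.
  have [dc|dc] := eqVneq d c.
    exists x, 0, [::]; rewrite addr0; split=> //; apply: lspan_incl.
    by split=> //; rewrite -dc.
  exists 0, x, [:: d]; rewrite add0r /= inE eq_sym; split=> //.
    by case: (lspan_sub (X `&` eigsp c)).
  by rewrite /shift xd subrr.
have Xc : lspan (X `&` eigsp c) `<=` eigsp c.
  by move=> y; apply; [exact: eigsp_sub|move=> z []].
have wE : eigsp c w.
  have -> : w = v - u by rewrite vuw addrC addKr.
  by apply: linear_subB => //; [exact: eigsp_sub|exact: Xc].
have sE : shifts s w = (\prod_(a <- s) (c - a)) *: w.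
  elim: {s0 vuw} s cs => [|a s IH]; first by rewrite big_nil scale1r.
  rewrite inE negb_or => /andP[_ /IH /= ->].
  have [_ _ sZ _] := linear_raddf (shift_linear a).
  by rewrite sZ /shift wE -scalerBl scalerA big_cons mulrC.
have /eqP : (\prod_(a <- s) (c - a)) *: w = 0 by rewrite -sE.
rewrite scaler_eq0 => /orP[|/eqP w0]; last by rewrite vuw w0 addr0.
rewrite prodf_seq_eq0 => /hasP[a sa]; rewrite subr_eq0 => /eqP ca.
by rewrite ca sa in cs.
Qed.

(** By [eigsp_lspan] only spanning vectors of eigenvalue [c] contribute, and these also have an
    eigenvalue in [D], so they vanish. All comparisons of degrees below rest on this. *)
Lemma eigsp_lspan0 (D : set F) c v : ~ D c ->
  lspan [set u | exists2 d, D d & eigsp d u] v -> eigsp c v -> v = 0.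
Proof.
move=> Dc Dv vc.
have DE u : [set u | exists2 d, D d & eigsp d u] u -> exists d, eigsp d u.
  by case=> d _ ud; exists d.
have := eigsp_lspan DE Dv vc.
move=> /(_ [set 0]); apply=> [|u [[d Dd ud] uc]] /=.
  by split=> // a u w -> ->; rewrite scaler0 addr0.
have /eqP : (d - c) *: u = 0 by rewrite scalerBl -ud -uc subrr.
rewrite scaler_eq0 subr_eq0 => /orP[/eqP dc|/eqP //].
by case: Dc; rewrite -dc.
Qed.

(** Each component is minus the sum of the others, whose eigenvalues differ from its own. Indices
    are kept apart from eigenvalues because the degrees of a Z-grading are integers, mapped
    injectively into F. *)
Lemma eigsp_indep (I : eqType) (m : I -> F) (s : seq I) (x : I -> V) :
    injective m -> uniq s -> (forall i, eigsp (m i) (x i)) ->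
    \sum_(i <- s) x i = 0 ->
  forall i, i \in s -> x i = 0.
Proof.
move=> mI us xE x0 i si.
have ci : ~ [set d | d <> m i] (m i) by move=> H; apply: H.
apply: (eigsp_lspan0 ci _ (xE i)).
have -> : x i = - \sum_(j <- s | j != i) x j.
  by apply/eqP; rewrite -addr_eq0 -(bigD1_seq i) //= x0.
apply: (linear_subN (lspan_sub _)).
apply: (linear_sub_sum _ (lspan_sub _)) => j ji.
apply: lspan_incl; exists (m j) => // /mI ij.
by rewrite ij eqxx in ji.
Qed.

End Eigenspaces.

(** * Modules and induction *)

Section SubspaceModule.
Variables (F : fieldType) (V : lmodType F) (W : set V).

(** The proof of linearity is an argument, so that the closure instance, and with it the module
    structure on [subspace], can be inferred from the predicate. *)
Definition subspace_pred of linear_sub W : {pred V} := fun v => `[< W v >].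

Variable WL : linear_sub W.

Lemma subspace_submod : submod_closed (subspace_pred WL).
Proof.
split=> [|a u v]; first by apply/asboolP; case: WL.
by move=> /asboolP Wu /asboolP Wv; apply/asboolP/WL.2.
Qed.
HB.instance Definition _ :=
  GRing.isSubmodClosed.Build F V (subspace_pred WL) subspace_submod.

Record subspace := Subspace { subspace_val : V; _ : subspace_pred WL subspace_val }.
HB.instance Definition _ := [isSub for subspace_val].
HB.instance Definition _ := [Choice of subspace by <:].
HB.instance Definition _ := [SubChoice_isSubLmodule of subspace by <:].

Lemma subspace_valP (v : subspace) : W (val v).
Proof. by case: v => v Wv; apply/asboolP. Qed.

Lemma insub_subspace v : W v -> val (insubd (0 : subspace) v) = v.
Proof. by move=> Wv; rewrite insubdK //; apply/asboolP. Qed.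

Lemma subspace_val_linear : linear (val : subspace -> V).
Proof. by move=> a u v; rewrite linearP. Qed.

End SubspaceModule.

Section Modules.
Variables (F : numFieldType) (g : lieSuper F).

Lemma graded2_indep (V : lmodType F) (P : bool -> set V) v0 v1 :
  grading P -> P false v0 -> P true v1 -> v0 + v1 = 0 -> v0 = 0 /\ v1 = 0.
Proof.
case=> _ _ PI P0 P1 v01; pose x b := if b then v1 else v0.
have Px b : P b (x b) by case: b.
have := PI [:: false; true] x isT Px.
rewrite !big_cons big_nil addr0 => /(_ v01) x0.
by split; [exact: (x0 false)|exact: (x0 true)].
Qed.

Section Restriction.
Variables (p : subalg g) (M : smod (full g)) (W : set M).
Hypotheses (WG : graded_sub (@sm_par F g _ M) W).
Hypotheses (Wp : forall x v, p x -> W v -> W (sm_act x v)).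

Let WL := WG.1.
Local Notation S := (subspace WL).

Definition restr_par b : set S := [set s | sm_par b (val s)].
(** For x outside [p] the vector may leave [W], and the value is then the default 0; the axioms of
    [smod p] only concern x in [p]. *)
Definition restr_act x (s : S) : S := insubd 0 (sm_act x (val s)).

Lemma restr_actE x s : p x -> val (restr_act x s) = sm_act x (val s).
Proof. by move=> px; rewrite insub_subspace //; apply: Wp => //; apply: subspace_valP. Qed.

Lemma restr_parP : grading restr_par.
Proof.
have [PL _ PI] := sm_parP M; have [v0 vD _ _] := linear_raddf (@subspace_val_linear _ _ _ WL).
split=> [b|v|s x us xP sx0 i si].
- split=> [|a u v Pu Pv]; rewrite /restr_par [X in X _]/mkset; first by rewrite v0; case: (PL b).
  by rewrite subspace_val_linear; apply: (PL b).2.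
- have [_ WD] := WG; have [w0 [w1 [P0 P1 W0 W1 vE]]] := WD _ (subspace_valP v).
  exists [:: false; true], (fun b => insubd (0 : S) (if b then w1 else w0)).
  split=> [b|]; first by rewrite [X in X _]/mkset insub_subspace; case: b.
  apply: val_inj; rewrite !big_cons big_nil addr0 vD !insub_subspace //.
apply: val_inj; rewrite v0.
apply: (PI s (fun b => val (x b))) => //.
by rewrite -(linear_sum _ _ _ (@subspace_val_linear _ _ _ WL)) sx0.
Qed.

Lemma restr_actDr x : p x -> linear (restr_act x).
Proof.
move=> px a u v; apply: val_inj; rewrite subspace_val_linear !restr_actE //.
by rewrite subspace_val_linear (@sm_actDr _ _ _ M x).
Qed.

Lemma restr_actDl v a x y : p x -> p y ->
  restr_act (a *: x + y) v = a *: restr_act x v + restr_act y v.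
Proof.
move=> px py; apply: val_inj; rewrite subspace_val_linear !restr_actE //.
  by rewrite sm_actDl.
by have [[_ pL] _] := sa_graded p; apply: pL.
Qed.

Lemma restr_act_par a b x v : p x -> ls_par a x -> restr_par b v ->
  restr_par (a (+) b) (restr_act x v).
Proof. by move=> px Px Pv; rewrite /restr_par /= restr_actE //; apply: sm_act_par. Qed.

Lemma restr_actM a b x y v : p x -> p y -> ls_par a x -> ls_par b y ->
  restr_act (ls_br x y) v =
  restr_act x (restr_act y v) - (-1) ^+ (a && b) *: restr_act y (restr_act x v).
Proof.
move=> px py Px Py; apply: val_inj.
have [_ vD vZ vN] := linear_raddf (@subspace_val_linear _ _ _ WL).
rewrite vD vN vZ !restr_actE //; first exact: sm_actM.
exact: sa_br.
Qed.

Definition restr_smod : smod p :=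
  @SMod F g p S restr_par restr_act restr_parP restr_actDr restr_actDl
    restr_act_par restr_actM.

End Restriction.

(** * The action of the enveloping algebra on a module *)

Section EnvelopingAction.
Variable M : smod (full g).
Local Notation U := (envel g).

Definition word_act (w : seq g) (m : M) : M := foldr (fun x => sm_act x) m w.

Lemma sm_act_linear x : linear (@sm_act F g _ M x).
Proof. exact: sm_actDr. Qed.

Lemma sm_act_linearl m : linear (fun x => @sm_act F g _ M x m).
Proof. by move=> a x y; rewrite sm_actDl. Qed.

Lemma word_act_linear w : linear (word_act w).
Proof. by rewrite /word_act; elim: w => //= x w IH a u v; rewrite IH sm_act_linear. Qed.

Definition env_act (u : U) (m : M) : M := plift (fun w => word_act w m) u.

Lemma env_act_rel m r : env_rel r -> fglift (fun w => word_act w m) r = 0.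
Proof.
apply: env_lift => [w1 w2 a x y|w1 w2 a b x y Px Py];
  rewrite /word_act !foldr_cat /= -!/(word_act _ _).
  by rewrite sm_act_linearl word_act_linear.
rewrite -word_act_linear (sm_actM _ _ _ Px Py) //; congr word_act.
by rewrite addrC subrK.
Qed.

Lemma env_act_linearl m : linear (env_act^~ m).
Proof. exact: (plift_linear (@env_act_rel m)). Qed.

Lemma env_actE w m : env_act (eword w) m = word_act w m.
Proof. exact: (plift_gen _ (@env_act_rel m)). Qed.

Lemma env_act_linearr u : linear (env_act u).
Proof.
move=> a m m'.
apply: (eword_ind (W := [set u | env_act u (a *: m + m') =
  a *: env_act u m + env_act u m'])) u => [|w].
  apply: linear_eq => [|c u v]; first exact: env_act_linearl.
  by rewrite !env_act_linearl !scalerDr !scalerA mulrC -!addrA;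
     congr (_ + _); rewrite addrCA.
by rewrite /= !env_actE word_act_linear.
Qed.

Lemma env_act_mulr u x m : env_act (u * einj x) m = env_act u (sm_act x m).
Proof.
apply: (eword_ind (W := [set u | env_act (u * einj x) m =
  env_act u (sm_act x m)])) u => [|w].
  apply: linear_eq => [c u v|]; last exact: env_act_linearl.
  by rewrite emul_linearl env_act_linearl.
by rewrite /= ewordM !env_actE /word_act foldr_cat.
Qed.

Lemma env_act_mull u x m : env_act (einj x * u) m = sm_act x (env_act u m).
Proof.
apply: (eword_ind (W := [set u | env_act (einj x * u) m =
  sm_act x (env_act u m)])) u => [|w].
  apply: linear_eq => c u v.
    by rewrite emul_linearr env_act_linearl.
  by rewrite env_act_linearl sm_act_linear.
by rewrite /= ewordM !env_actE.
Qed.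

Lemma env_act_par a b u (m : M) :
  env_par a u -> sm_par b m -> sm_par (a (+) b) (env_act u m).
Proof.
move=> Pu Pm; have [PL _ _] := sm_parP M.
apply: (Pu [set u | sm_par (a (+) b) (env_act u m)]).
  split=> [|c v v'] /=; last by rewrite env_act_linearl; apply: (PL _).2.
  by have [-> _ _ _] := linear_raddf (env_act_linearl m); case: (PL (a (+) b)).
move=> _ [w aw <-] /=; rewrite env_actE.
elim: w a aw {Pu u} => [|x w IH] a /=; first by case: a.
case=> c [Px wP]; have -> : a (+) b = c (+) ((c (+) a) (+) b).
  by rewrite !addbA addbb addFb.
by apply: sm_act_par => //; apply: IH.
Qed.

End EnvelopingAction.

(** * Frobenius reciprocity: extending a map of [p]-modules to the induced module *)

Section Frobenius.
Variables (p : subalg g) (S : smod p) (M : smod (full g)) (f : S -> M).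
Hypotheses (fL : linear f) (fP : forall a s, sm_par a s -> sm_par a (f s)).
Hypothesis fA : forall x s, p x -> f (sm_act x s) = sm_act x (f s).

Definition ind_hom (q : Ind S) : M :=
  plift (fun us : envel g * S => env_act us.1 (f us.2)) q.

Lemma ind_hom_rel r : ind_rel r ->
  fglift (fun us : envel g * S => env_act us.1 (f us.2)) r = 0.
Proof.
apply: (ind_lift (f := fun u s => env_act u (f s))) => [s|u a s s'|u x s px].
- exact: env_act_linearl.
- by rewrite fL env_act_linearr.
- by rewrite env_act_mulr fA.
Qed.

Lemma ind_hom_linear : linear ind_hom.
Proof. exact: (plift_linear ind_hom_rel). Qed.

Lemma ind_homE u s : ind_hom (tens u s) = env_act u (f s).
Proof. exact: (plift_gen _ ind_hom_rel). Qed.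

Lemma ind_homP : smod_hom ind_hom.
Proof.
split=> [|a v Pv|x v _]; first exact: ind_hom_linear.
  have [PL _ _] := sm_parP M.
  apply: (Pv [set v | sm_par a (ind_hom v)]).
    split=> [|c u u'] /=; last by rewrite ind_hom_linear; apply: (PL _).2.
    by have [-> _ _ _] := linear_raddf ind_hom_linear; case: (PL a).
  move=> _ [b [c [u [s [<- Pu Ps ->]]]]] /=; rewrite ind_homE.
  by apply: env_act_par => //; apply: fP.
apply: (tens_ind (W := [set v | ind_hom (sm_act x v) = sm_act x (ind_hom v)])) v.
  apply: linear_eq => c u v.
    by rewrite sm_act_linear ind_hom_linear.
  by rewrite ind_hom_linear sm_act_linear.
by move=> u s; rewrite /= ind_actE !ind_homE env_act_mull.
Qed.

(** The image of [ind_hom] is a graded submodule containing [f s], which is nonzero; simplicity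
    makes it all of M. *)
Lemma ind_simple_quotient s : f s <> 0 -> simple M -> simple_quotient (Ind S) M.
Proof.
move=> fs0 Msimple; split=> //; exists ind_hom; split; first exact: ind_homP.
have [_ homP homA] := ind_homP.
have [h0 hD _ _] := linear_raddf ind_hom_linear.
have [] := Msimple.2 (range ind_hom); first split.
- split=> [|_ [q _ <-]].
    split=> [|a _ _ [q _ <-] [q' _ <-]]; first by exists 0.
    by exists (a *: q + q') => //; rewrite ind_hom_linear.
  have [q0 [q1 [P0 P1 ->]]] := grading2 q (sm_parP (Ind S)).
  exists (ind_hom q0), (ind_hom q1); split; first exact: homP; first exact: homP.
  - by exists q0.
  - by exists q1.
  - by rewrite hD.
- by move=> x _ _ [q _ <-]; exists (sm_act x q) => //; rewrite homA.
- move=> r0; case: fs0.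
  have : range ind_hom (f s).
    by exists (tens (eword [::]) s) => //; rewrite ind_homE env_actE.
  by rewrite r0.
- move=> rT v; have [u _ uE] : range ind_hom v by rewrite rT.
  by exists u.
Qed.

End Frobenius.

End Modules.

(** * Parabolic induction *)

Section Homogeneous.
Variables (F : numFieldType).

(** The images of the two components have opposite parities, so their sum can only vanish termwise.
    This is what makes eigenspaces and annihilated subspaces graded. *)
Lemma hom_ker_graded (V V' : lmodType F) (P : bool -> set V) (P' : bool -> set V')
    (f : V -> V') b v0 v1 :
    grading P' -> linear f -> (forall a v, P a v -> P' (a (+) b) (f v)) ->
    P false v0 -> P true v1 -> f (v0 + v1) = 0 ->
  f v0 = 0 /\ f v1 = 0.
Proof.
move=> PG fL fP /fP P0 /fP P1; have [_ -> _ _] := linear_raddf fL.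
case: b fP P0 P1 => _ /= P0 P1 f01; last exact: graded2_indep PG P0 P1 f01.
by rewrite addrC in f01; have [] := graded2_indep PG P1 P0 f01.
Qed.

Variable g : lieSuper F.

(** For even [x] the sign in the Jacobi identity does not depend on [y], so [y] may be
    inhomogeneous. *)
Lemma ls_brJ_even (x y z : g) : ls_par false x ->
  ls_br x (ls_br y z) = ls_br (ls_br x y) z + ls_br y (ls_br x z).
Proof.
move=> Px; have [y0 [y1 [P0 P1 ->]]] := grading2 y (ls_parP g).
have [_ rD _ _] := linear_raddf (ls_brDr x).
have D u v w : ls_br (u + v) w = ls_br u w + ls_br v w :> g.
  by have [_ -> _ _] := linear_raddf (ls_brDl w).
by rewrite !D !rD !D (ls_brJ _ Px P0) (ls_brJ _ Px P1) /= !scale1r addrACA.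
Qed.

Variable M : smod (full g).

Lemma sm_act_br a b x y (m : M) : ls_par a x -> ls_par b y ->
  sm_act x (sm_act y m) =
  sm_act (ls_br x y) m + (-1) ^+ (a && b) *: sm_act y (sm_act x m).
Proof. by move=> Px Py; rewrite (sm_actM _ _ _ Px Py) // subrK. Qed.

Lemma sm_act_br_even x y (m : M) : ls_par false x ->
  sm_act x (sm_act y m) = sm_act (ls_br x y) m + sm_act y (sm_act x m).
Proof.
move=> Px; have [y0 [y1 [P0 P1 ->]]] := grading2 y (ls_parP g).
have [_ rD _ _] := linear_raddf (ls_brDr x).
have [_ xD _ _] := linear_raddf (@sm_act_linear _ _ M x).
have D u v m' : sm_act (u + v) m' = sm_act u m' + sm_act v m' :> M.
  by have [_ -> _ _] := linear_raddf (sm_act_linearl m').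
by rewrite !D xD rD D (sm_act_br _ Px P0) (sm_act_br _ Px P1) /= !scale1r addrACA.
Qed.

End Homogeneous.

(** * A criterion for parabolic induction: a nonzero eigenvector of H killed by all positive
    degrees *)

Section ParabolicCriterion.
Variables (F : numFieldType) (n : nat) (g : lieSuper F) (h : 'I_n -> g).
Variables (c : 'I_n -> F).
Hypotheses (h_even : forall i, ls_par false (h i)).
Hypotheses (h_comm : forall i j, ls_br (h i) (h j) = 0).

Definition cartan_elt : g := \sum_i c i *: h i.
Local Notation H := cartan_elt.

(** Only integers serve as degrees; the hypothesis [gr_span] ensures that these eigenspaces exhaust
    [g]. *)
Definition ad_grading (j : int) : set g := eigsp (ls_br H) j%:~R.
Local Notation gr := ad_grading.

Hypothesis gr_span : forall x : g, exists (s : seq int) (y : int -> g),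
  (forall j, gr j (y j)) /\ x = \sum_(j <- s) y j.

Lemma cartan_elt_even : ls_par false H.
Proof.
have [PL _ _] := ls_parP g.
by apply: (linear_sub_sum _ (PL false)) => i _; apply: (linear_subZ _ (PL false)).
Qed.
Let H_even := cartan_elt_even.

Let gr_sub j : linear_sub (gr j).
Proof. exact: eigsp_sub (ls_brDr H) _. Qed.

Lemma ad_grading_graded j : graded_sub (@ls_par F g) (gr j).
Proof.
split=> // x xj; have [x0 [x1 [P0 P1 xE]]] := grading2 x (ls_parP g).
have adL : linear (fun x => ls_br H x - j%:~R *: x).
  move=> a u v; rewrite ls_brDr scalerDr scalerBr !scalerA mulrC opprD.
  by rewrite addrACA.
have adP a u : ls_par a u -> ls_par (a (+) false) (ls_br H u - j%:~R *: u).
  move=> Pu; have [PL _ _] := ls_parP g; rewrite addbF.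
  by apply: (linear_subB (PL a)); [apply: (ls_br_par H_even Pu)|apply: (linear_subZ _ (PL a))].
have [|x0j x1j] := hom_ker_graded (ls_parP g) adL adP P0 P1.
  by rewrite -xE xj subrr.
by exists x0, x1; split=> //; apply/subr0_eq.
Qed.

Lemma ad_grading_br i j x y : gr i x -> gr j y -> gr (i + j) (ls_br x y).
Proof.
move=> xi yj; rewrite /gr /eigsp /= ls_brJ_even // xi yj.
have [_ _ -> _] := linear_raddf (ls_brDl y).
have [_ _ -> _] := linear_raddf (ls_brDr x).
by rewrite -scalerDl intrD.
Qed.

Lemma cartan_elt_comm i : ls_br H (h i) = 0.
Proof.
rewrite (linear_sum _ _ _ (ls_brDl (h i))) big1 // => l _.
by have [_ _ -> _] := linear_raddf (ls_brDl (h i)); rewrite h_comm scaler0.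
Qed.

Lemma ad_grading_Z : Z_grading h gr.
Proof.
split=> [|||x hx].
- split=> [//||s x us xE x0 i si]; first exact: gr_span.
  exact: (eigsp_indep (ls_brDr H) intr_inj us xE x0 si).
- exact: ad_grading_graded.
- exact: ad_grading_br.
apply: hx => // _ [i _ <-].
by rewrite /gr /eigsp /= cartan_elt_comm scale0r.
Qed.

Definition ad_nonneg : set g := lspan [set y | exists2 j, 0 <= j & gr j y].

Lemma ad_nonneg_graded : graded_sub (@ls_par F g) ad_nonneg.
Proof.
split=> [|x xp]; first exact: lspan_sub.
apply: (xp [set x | exists v0 v1,
    [/\ ls_par false v0, ls_par true v1, ad_nonneg v0, ad_nonneg v1 & x = v0 + v1]]).
  have [PL _ _] := ls_parP g; have NL : linear_sub ad_nonneg := lspan_sub _.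
  split=> [|a _ _ [u0 [u1 [? ? ? ? ->]]] [v0 [v1 [? ? ? ? ->]]]] /=.
    by exists 0, 0; rewrite addr0; split=> //; [case: (PL false)|case: (PL true)|case: NL|case: NL].
  exists (a *: u0 + v0), (a *: u1 + v1).
  split; [exact: (PL _).2|exact: (PL _).2|exact: NL.2|exact: NL.2|].
  by rewrite scalerDr addrACA.
move=> y [j j0 yj]; have [_ /(_ y yj) [y0 [y1 [P0 P1 y0j y1j ->]]]] := ad_grading_graded j.
by exists y0, y1; split=> //; apply: lspan_incl; exists j.
Qed.

Lemma ad_nonneg_br x y : ad_nonneg x -> ad_nonneg y -> ad_nonneg (ls_br x y).
Proof.
move=> xp yp; apply: (xp [set x | ad_nonneg (ls_br x y)]).
  have [z _ _ _] := linear_raddf (ls_brDl y).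
  split=> [|a u v] /=; first by rewrite z; case: (lspan_sub [set y | exists2 j, 0 <= j & gr j y]).
  by rewrite ls_brDl; apply: (lspan_sub _).2.
move=> {xp}x [i i0 xi] /=; apply: (yp [set y | ad_nonneg (ls_br x y)]).
  have [z _ _ _] := linear_raddf (ls_brDr x).
  split=> [|a u v] /=; first by rewrite z; case: (lspan_sub [set y | exists2 j, 0 <= j & gr j y]).
  by rewrite ls_brDr; apply: (lspan_sub _).2.
move=> {yp}y [j j0 yj] /=; apply: lspan_incl; exists (i + j); first exact: addr_ge0.
exact: ad_grading_br.
Qed.

Definition ad_parabolic : subalg g := Subalg ad_nonneg_graded ad_nonneg_br.

Lemma ad_parabolicP : parabolic h ad_parabolic.
Proof. by exists gr; split; first exact: ad_grading_Z. Qed.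

Lemma ad_parabolic_proper (j : int) x : j < 0 -> gr j x -> x <> 0 -> ~ ad_parabolic x.
Proof.
move=> j0 xj x0 xp; apply: x0.
apply: (@eigsp_lspan0 _ _ _ (ls_brDr H) [set d | exists2 i : int, 0 <= i & d = i%:~R] _ _ _ _ xj).
  by case=> i i0 /intr_inj ji; rewrite ji ltNge i0 in j0.
move=> W WL WP; apply: xp => // y [i i0 yi]; apply: WP => /=.
by exists i%:~R => //; exists i.
Qed.

Variables (M : smod (full g)) (d : F).
Hypotheses (M_simple : simple M) (M_weight : weight_module h M).

Local Notation eigM := (eigsp (@sm_act F g _ M H) d).

Let actH_linear : linear (@sm_act F g _ M H) := @sm_act_linear F g M H.

(** A priori only the singular vectors in the eigenspace of [d]. As soon as one of them is nonzero
    they fill it, which is shown in [ad_parabolically_induced]. *)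
Definition ad_top : set M :=
  [set m | eigsp (@sm_act F g _ M H) d m /\
    forall j x, 0 < j -> gr j x -> sm_act x m = 0].

Lemma ad_shift e j x (m : M) : gr j x -> sm_act H m = e *: m ->
  sm_act H (sm_act x m) = (e + j%:~R) *: sm_act x m.
Proof.
move=> xj me; rewrite sm_act_br_even // xj me.
have [_ _ -> _] := linear_raddf (sm_act_linearl m).
have [_ _ -> _] := linear_raddf (@sm_act_linear _ _ M x).
by rewrite -scalerDl addrC.
Qed.

Let actD x y (m : M) : sm_act (x + y) m = sm_act x m + sm_act y m.
Proof. by have [_ -> _ _] := linear_raddf (sm_act_linearl m). Qed.
Let actDr x (m m' : M) : sm_act x (m + m') = sm_act x m + sm_act x m'.
Proof. by have [_ -> _ _] := linear_raddf (@sm_act_linear _ _ M x). Qed.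
Let act0r x : sm_act x (0 : M) = 0.
Proof. by have [-> _ _ _] := linear_raddf (@sm_act_linear _ _ M x). Qed.

Lemma ad_top_graded : graded_sub (@sm_par F g _ M) ad_top.
Proof.
split.
  split=> [|a u v [ud un] [vd vn]].
    by split=> [|j x _ _]; [case: (eigsp_sub actH_linear d)|].
  split=> [|j x j0 xj]; first exact: (eigsp_sub actH_linear d).2.
  by rewrite sm_act_linear (un _ _ j0 xj) (vn _ _ j0 xj) scaler0 addr0.
move=> m [md mn]; have [m0 [m1 [P0 P1 mE]]] := grading2 m (sm_parP M).
have HL : linear (fun m : M => sm_act H m - d *: m).
  move=> a u v; rewrite sm_act_linear scalerDr scalerBr !scalerA mulrC opprD.
  by rewrite addrACA.
have HP a (u : M) : sm_par a u -> sm_par (a (+) false) (sm_act H u - d *: u).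
  move=> Pu; have [PL _ _] := sm_parP M; rewrite addbF.
  apply: (linear_subB (PL a)); last exact: (linear_subZ _ (PL a)).
  exact: (sm_act_par _ H_even Pu).
have [|m0d m1d] := hom_ker_graded (sm_parP M) HL HP P0 P1.
  by rewrite -mE md subrr.
have top_comp j x : 0 < j -> gr j x -> sm_act x m0 = 0 /\ sm_act x m1 = 0.
  move=> j0 xj; have [_ /(_ x xj) [x0 [x1 [Q0 Q1 x0j x1j ->]]]] := ad_grading_graded j.
  have hom b y : ls_par b y -> gr j y -> sm_act y m0 = 0 /\ sm_act y m1 = 0.
    move=> Py yj; apply: (hom_ker_graded (b := b) (sm_parP M) (@sm_act_linear _ _ M y) _ P0 P1).
      by move=> a u Pu; rewrite addbC; apply: sm_act_par.
    by rewrite -mE (mn _ _ j0 yj).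
  have [z00 z01] := hom _ _ Q0 x0j; have [z10 z11] := hom _ _ Q1 x1j.
  by rewrite !actD z00 z01 z10 z11 addr0.
exists m0, m1; split=> //; 
  by split=> [|j x j0 xj]; [exact/subr0_eq|have [] := top_comp j x j0 xj].
Qed.

(** Positive degrees kill [m]. For x of degree 0 and y of degree i > 0, y (x m) is [y, x] m plus or
    minus x (y m); both terms vanish because [y, x] has degree i again. *)
Lemma ad_top_stable x m : ad_parabolic x -> ad_top m -> ad_top (sm_act x m).
Proof.
move=> xp [md mn]; have TL := ad_top_graded.1.
apply: (xp [set x | ad_top (sm_act x m)]).
  have [z _ _ _] := linear_raddf (sm_act_linearl m).
  split=> [|a u v] /=; first by rewrite z; case: TL.
  by rewrite sm_act_linearl; apply: TL.2.
move=> {xp}x [j]; rewrite le_eqVlt => /orP[/eqP<- x0|j0 xj] /=; last first.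
  by rewrite (mn _ _ j0 xj); case: TL.
split=> [|i y i0 yi]; first by rewrite /eigsp /= (ad_shift x0 md) addr0.
have [_ /(_ x x0) [x1 [x2 [P1 P2 x1j x2j ->]]]] := ad_grading_graded 0.
have [_ /(_ y yi) [y1 [y2 [Q1 Q2 y1j y2j ->]]]] := ad_grading_graded i.
have hom a b u v : ls_par a u -> ls_par b v -> gr i u -> gr 0 v ->
    sm_act u (sm_act v m) = 0.
  move=> Pu Pv uj v0; rewrite (sm_act_br _ Pu Pv) (mn _ _ i0 uj) act0r scaler0 addr0.
  by apply: (mn _ _ i0); rewrite -(addr0 i); apply: ad_grading_br.
rewrite !(actD, actDr) (hom _ _ _ _ Q1 P1) // (hom _ _ _ _ Q1 P2) //.
by rewrite (hom _ _ _ _ Q2 P1) // (hom _ _ _ _ Q2 P2) // !addr0.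
Qed.

(* M is obtained from W by applying the negative part of g, which strictly
   lowers the eigenvalue of H: nothing else has eigenvalue d. *)
Lemma ad_top_generates (W : set M) w :
    graded_sub (@sm_par F g _ M) W -> W `<=` ad_top ->
    (forall x m, ad_parabolic x -> W m -> W (sm_act x m)) ->
    W w -> w <> 0 ->
  forall m, eigsp (@sm_act F g _ M H) d m -> W m.
Proof.
move=> WG Wtop Wp Ww w0 m md; have WL := WG.1.
pose lower := [set x | exists a j, [/\ j < 0, gr j x & ls_par a x]].
pose N := [set m : M | forall X : set M, linear_sub X -> W `<=` X ->
  (forall x u, lower x -> X u -> X (sm_act x u)) -> X m].
have NL : linear_sub N.
  split=> [X [] //|a u v Nu Nv X XL WX Xlow].
  by apply: XL.2; [apply: Nu|apply: Nv].
have NW : W `<=` N by move=> u Wu X _ WX _; apply: WX.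
have Nlow x u : lower x -> N u -> N (sm_act x u).
  by move=> xl Nu X XL WX Xlow; apply: (Xlow _ _ xl); apply: Nu.
have Nact x u : N u -> N (sm_act x u).
  (* The induction hypothesis covers all x at once: for y in [lower], x (y v) is [x, y] v plus or
     minus y (x v), and [x, y] is again some element of [g]. *)
  move=> Nu; suff [_ Au] : N u /\ forall x, N (sm_act x u) by exact: Au.
  apply: (Nu [set u | N u /\ forall x, N (sm_act x u)]) => [|v Wv|y v [a [j [j0 yj Py]]] [Nv Nxv]].
  - split=> [|a u1 u2 [N1 A1] [N2 A2]] /=.
      by split=> [|y]; rewrite ?act0r; case: NL.
    by split=> [|y]; rewrite ?sm_act_linear; apply: NL.2.
  - split=> [|y]; first exact: NW.
    have [s [z [zE ->]]] := gr_span y.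
    rewrite (linear_sum _ _ _ (sm_act_linearl v)).
    apply: (linear_sub_sum _ NL) => j _.
    have [j0|j0] := ltP j 0; last first.
      by apply: NW; apply: Wp => //; apply: lspan_incl; exists j.
    have [_ /(_ _ (zE j)) [z0 [z1 [P0 P1 z0j z1j ->]]]] := ad_grading_graded j.
    rewrite actD; apply: (linear_subD NL); apply: Nlow.
    + by exists false, j.
    + exact: NW.
    + by exists true, j.
    + exact: NW.
  have yl : lower y by exists a, j.
  split=> [|x']; first exact: Nlow.
  have hom b z : ls_par b z -> N (sm_act z (sm_act y v)).
    move=> Pz; rewrite (sm_act_br _ Pz Py); apply: (linear_subD NL); first exact: Nxv.
    by apply: (linear_subZ _ NL); apply: Nlow.
  have [z0 [z1 [P0 P1 ->]]] := grading2 x' (ls_parP g).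
  by rewrite actD; apply: (linear_subD NL); [apply: (hom false)|apply: (hom true)].
have NG : graded_sub (@sm_par F g _ M) N.
  have [PL _ _] := sm_parP M.
  split=> // u Nu; apply: (Nu [set u | exists v0 v1,
    [/\ sm_par false v0, sm_par true v1, N v0, N v1 & u = v0 + v1]]) => [|v Wv|y v [a [j [j0 yj Py]]] [v0 [v1 [P0 P1 N0 N1 ->]]]].
  - split=> [|a _ _ [u0 [u1 [? ? ? ? ->]]] [v0 [v1 [? ? ? ? ->]]]] /=.
      by exists 0, 0; rewrite addr0; split=> //; [case: (PL false)|case: (PL true)|case: NL|case: NL].
    exists (a *: u0 + v0), (a *: u1 + v1).
    split; [exact: (PL _).2|exact: (PL _).2|exact: NL.2|exact: NL.2|].
    by rewrite scalerDr addrACA.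
  - have [_ /(_ v Wv) [v0 [v1 [P0 P1 W0 W1 ->]]]] := WG.
    by exists v0, v1; split=> //; apply: NW.
  have Q0 := sm_act_par (p := full g) I Py P0; have Q1 := sm_act_par (p := full g) I Py P1.
  rewrite actDr; have yl : lower y by exists a, j.
  case: a {Py} Q0 Q1 => Q0 Q1.
    by exists (sm_act y v1), (sm_act y v0); rewrite addrC; split=> //; apply: Nlow.
  by exists (sm_act y v0), (sm_act y v1); split=> //; apply: Nlow.
have {Nact NG} NT : N = setT.
  have [//|N0|//] := M_simple.2 N; first by split=> // x u _; apply: Nact.
  by case: w0; have : N w := NW _ Ww; rewrite N0.
pose D := [set e | exists2 j : int, j < 0 & e = d + j%:~R].
pose low := lspan [set u | exists2 e, D e & eigsp (@sm_act F g _ M H) e u].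
have lowL : linear_sub low := lspan_sub _.
have [u [v [Wu lv mE]]] : exists u v, [/\ W u, low v & m = u + v].
  have : N m by rewrite NT.
  move/(_ [set m | exists u v, [/\ W u, low v & m = u + v]]); apply.
  - split=> [|a _ _ [u0 [u1 [? ? ->]]] [v0 [v1 [? ? ->]]]] /=.
      by exists 0, 0; rewrite addr0; split=> //; [case: WL|case: lowL].
    exists (a *: u0 + v0), (a *: u1 + v1).
    by split; [exact: WL.2|exact: lowL.2|rewrite scalerDr addrACA].
  - by move=> u Wu; exists u, 0; rewrite addr0; split=> //; case: lowL.
  move=> x _ [a [j [j0 xj _]]] [u [v [Wu lv ->]]].
  exists 0, (sm_act x (u + v)); rewrite add0r; split=> //; first by case: WL.
  rewrite actDr; apply: (linear_subD lowL).
    apply: lspan_incl; exists (d + j%:~R); first by exists j.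
    by apply: ad_shift => //; have [] := Wtop _ Wu.
  apply: (lv [set v | low (sm_act x v)]).
    split=> [|b v1 v2] /=; first by rewrite act0r; case: lowL.
    by rewrite sm_act_linear; apply: lowL.2.
  move=> _v [e [i i0 ->] ve] /=; apply: lspan_incl.
  exists (d + (i + j)%:~R); first by exists (i + j) => //; rewrite -[0]addr0 ltrD.
  by rewrite intrD addrA; apply: ad_shift.
suff v0 : v = 0 by rewrite mE v0 addr0.
apply: (@eigsp_lspan0 _ _ _ actH_linear D d v _ lv) => [[j j0 /eqP]|].
  by rewrite -{1}[d]addr0 (inj_eq (addrI d)) eq_sym intr_eq0 => /eqP j0'; rewrite j0' ltxx in j0.
have -> : v = m - u by rewrite mE addrC addKr.
apply: (linear_subB (eigsp_sub actH_linear d)) => //.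
by have [] := Wtop _ Wu.
Qed.

Lemma weight_cartan_elt (mu : 'rV[F]_n) (m : M) :
  weight_space h M mu m -> sm_act H m = (\sum_i c i * mu 0 i) *: m.
Proof.
move=> mE; rewrite (linear_sum _ _ _ (sm_act_linearl m)) scaler_suml.
apply: eq_bigr => i _; have [_ _ -> _] := linear_raddf (sm_act_linearl m).
by rewrite mE scalerA.
Qed.

(** [ad_top_generates] serves twice. Applied to [ad_top] itself, it identifies [ad_top] with the
    eigenspace of [d]; applied to a nonzero submodule of it, it gives simplicity. The inclusion into
    M then extends to the induced module. *)
Lemma ad_parabolically_induced v : v <> 0 -> ad_top v ->
  parabolically_induced h ad_parabolic M.
Proof.
move=> v0 vtop; pose S := restr_smod ad_top_graded ad_top_stable.
have vL := @subspace_val_linear _ _ _ ad_top_graded.1.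
have [val0 valD valZ _] := linear_raddf vL.
have hp i : ad_parabolic (h i).
  apply: lspan_incl; exists 0 => //.
  by rewrite /gr /eigsp /= cartan_elt_comm scale0r.
have sub_act x (s : S) : ad_parabolic x -> val (sm_act x s) = sm_act x (val s).
  by move=> xp; apply: (restr_actE ad_top_stable).
have top_eig m : eigsp (@sm_act F g _ M H) d m -> ad_top m.
  by apply: (ad_top_generates ad_top_graded _ ad_top_stable vtop v0).
exists S; split.
- split; first by exists (insubd 0 v) => /(congr1 val); rewrite insub_subspace ?val0.
  move=> W [WG Wp].
  have [[w [Ww w0]]|W0] := pselect (exists w, W w /\ w <> 0); last first.
    left; apply/seteqP; split=> [w Ww|_ ->]; last by case: WG.1.
    by apply: contrapT => w0; apply: W0; exists w.
  right; apply/seteqP; split=> // s _.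
  pose W' : set M := [set val w | w in W].
  suff [s' Ws' /val_inj <-] : W' (val s) by [].
  apply: (@ad_top_generates W' (val w)).
  + split=> [|_ [u Wu <-]].
      split=> [|a _ _ [u1 W1 <-] [u2 W2 <-]]; first by exists 0 => //; case: WG.1.
      by exists (a *: u1 + u2); rewrite ?vL //; apply: WG.1.2.
    have [_ /(_ u Wu) [u0 [u1 [P0 P1 W0 W1 ->]]]] := WG.
    exists (val u0), (val u1); split=> //; [by exists u0|by exists u1].
  + by move=> _ [u _ <-]; apply: subspace_valP.
  + by move=> x _ px [u Wu <-]; exists (sm_act x u); [apply: Wp|apply: sub_act].
  + by exists w.
  + by move=> w'0; apply: w0; apply: val_inj; rewrite w'0 val0.
  + by have [] := subspace_valP s.
- have [PL _ PI] := M_weight; split=> [mu|s|s x us xE x0 i si].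
  + split=> [i|a u u' uE u'E i]; apply: val_inj.
      by rewrite sub_act // valZ val0 act0r scaler0.
    rewrite sub_act // valZ vL sm_act_linear -!sub_act // uE u'E.
    by rewrite !valZ scalerDr !scalerA mulrC.
  + have [t [x [ut xE sE]]] := grading_uniq (val s) M_weight.
    (* H acts on each weight space by a scalar, so independence of the weight spaces forces every
       weight component of [s] to have eigenvalue [d]. *)
    have xd mu : mu \in t -> ad_top (x mu).
      move=> tmu; apply: top_eig; apply/subr0_eq.
      apply: (PI t (fun mu => sm_act H (x mu) - d *: x mu)) => //.
        move=> nu; rewrite (weight_cartan_elt (xE nu)).
        by apply: (linear_subB (PL nu)); apply: (linear_subZ _ (PL nu)).
      rewrite sumrB -(linear_sum _ _ _ actH_linear) -scaler_sumr -sE.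
      by have [-> _] := subspace_valP s; rewrite subrr.
    exists t, (fun mu => if mu \in t then insubd 0 (x mu) else 0).
    split=> [mu i|].
      case: ifP => tmu; apply: val_inj; rewrite sub_act // valZ; last first.
        by rewrite val0 act0r scaler0.
      by rewrite insub_subspace ?xE //; apply: xd.
    apply: val_inj; rewrite (linear_sum _ _ _ vL) sE big_seq [RHS]big_seq.
    by apply: eq_bigr => mu tmu; rewrite tmu insub_subspace //; apply: xd.
  + apply: val_inj; rewrite val0; apply: (PI s (fun mu => val (x mu))) => //.
      by move=> mu l; rewrite -sub_act // xE valZ.
    by rewrite -(linear_sum _ _ _ vL) x0.
apply: (@ind_simple_quotient _ _ _ S M val vL _ sub_act (insubd 0 v)) => //.
by rewrite insub_subspace.
Qed.

End ParabolicCriterion.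

(** * Structure of D(2,1,alpha) *)

Section Brackets.
Variables (F : numFieldType) (g : lieSuper F).
Implicit Types x y z : g.

Lemma brDl x y z : ls_br (x + y) z = ls_br x z + ls_br y z.
Proof. by have [_ -> _ _] := linear_raddf (ls_brDl z). Qed.
Lemma brDr x y z : ls_br z (x + y) = ls_br z x + ls_br z y.
Proof. by have [_ -> _ _] := linear_raddf (ls_brDr z). Qed.
Lemma brZl a x z : ls_br (a *: x) z = a *: ls_br x z.
Proof. by have [_ _ -> _] := linear_raddf (ls_brDl z). Qed.
Lemma brZr a x z : ls_br z (a *: x) = a *: ls_br z x.
Proof. by have [_ _ -> _] := linear_raddf (ls_brDr z). Qed.
Lemma brNr x z : ls_br z (- x) = - ls_br z x.
Proof. by have [_ _ _ ->] := linear_raddf (ls_brDr z). Qed.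
Lemma br0l z : ls_br 0 z = 0 :> g.
Proof. by have [-> _ _ _] := linear_raddf (ls_brDl z). Qed.
Lemma br0r z : ls_br z 0 = 0 :> g.
Proof. by have [-> _ _ _] := linear_raddf (ls_brDr z). Qed.

Lemma br_oddJ x y z : ls_par true x -> ls_par true y ->
  ls_br x (ls_br y z) = ls_br (ls_br x y) z - ls_br y (ls_br x z).
Proof. by move=> Px Py; rewrite (ls_brJ _ Px Py) /= expr1 scaleN1r. Qed.

Lemma br_oddC x y : ls_par true x -> ls_par true y -> ls_br x y = ls_br y x.
Proof. by move=> Px Py; rewrite (ls_brC Px Py) /= expr1 scaleN1r opprK. Qed.

Lemma br_evenC a x y : ls_par a x -> ls_par false y -> ls_br x y = - ls_br y x.
Proof. by move=> Px Py; rewrite (ls_brC Px Py) andbF scale1r. Qed.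

Lemma addv_self0 (V : lmodType F) (v : V) : v = - v -> v = 0.
Proof.
move=> vN; have /eqP : (2 : F) *: v = 0 by rewrite scaler_nat mulr2n {1}vN addNr.
by rewrite scaler_eq0 pnatr_eq0 => /eqP.
Qed.

(** For odd [x] the Jacobi identity says that ad [x, x] is twice the square of ad x. *)
Lemma br_odd_sqr0 x z : ls_par true x -> ls_br x x = 0 -> ls_br x (ls_br x z) = 0.
Proof.
by move=> Px xx; apply: addv_self0; rewrite {1}br_oddJ // xx br0l sub0r.
Qed.

(** The normalizer of [J] is closed under brackets. Since the Jacobi identity is stated for
    homogeneous elements, the induction runs over elements whose two parity components both
    normalize [J]. *)
Lemma generated_stable n (e f h : 'I_n -> g) (J : set g) :
    generated e f h ->
    (forall i, [/\ ls_par true (e i), ls_par true (f i) & ls_par false (h i)]) ->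
    linear_sub J ->
    (forall i y, J y -> [/\ J (ls_br (e i) y), J (ls_br (f i) y) & J (ls_br (h i) y)]) ->
  forall x y, J y -> J (ls_br x y).
Proof.
move=> gen par JL Jg x y Jy.
pose norm x := forall y, J y -> J (ls_br x y).
have [PL _ _] := ls_parP g.
have norm0 : norm 0 by move=> z _; rewrite br0l; case: JL.
have normD a u v : norm u -> norm v -> norm (a *: u + v).
  move=> Nu Nv z Jz; rewrite brDl brZl; apply: JL.2; [exact: Nu|exact: Nv].
have normB a b u v : ls_par a u -> ls_par b v -> norm u -> norm v -> norm (ls_br u v).
  move=> Pu Pv Nu Nv z Jz.
  have -> : ls_br (ls_br u v) z =
      ls_br u (ls_br v z) - (-1) ^+ (a && b) *: ls_br v (ls_br u z).
    by rewrite (ls_brJ _ Pu Pv) addrK.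
  apply: (linear_subB JL); first by apply: Nu; apply: Nv.
  by apply: (linear_subZ _ JL); apply: Nv; apply: Nu.
suff [x0 [x1 [_ _ N0 N1 ->]]] : exists x0 x1,
    [/\ ls_par false x0, ls_par true x1, norm x0, norm x1 & x = x0 + x1].
  by rewrite brDl; apply: (linear_subD JL); [exact: N0|exact: N1].
apply: (gen [set x | exists x0 x1,
    [/\ ls_par false x0, ls_par true x1, norm x0, norm x1 & x = x0 + x1]]).
- split=> [|a _ _ [u0 [u1 [? ? ? ? ->]]] [v0 [v1 [? ? ? ? ->]]]] /=.
    by exists 0, 0; rewrite addr0; split=> //; [case: (PL false)|case: (PL true)].
  exists (a *: u0 + v0), (a *: u1 + v1).
  split; [exact: (PL _).2|exact: (PL _).2|exact: normD|exact: normD|].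
  by rewrite scalerDr addrACA.
- move=> _ _ [u0 [u1 [P0 P1 N0 N1 ->]]] [v0 [v1 [Q0 Q1 M0 M1 ->]]] /=.
  exists (ls_br u0 v0 + ls_br u1 v1), (ls_br u0 v1 + ls_br u1 v0); split.
  + by apply: (linear_subD (PL false)); [apply: (ls_br_par P0 Q0)|apply: (ls_br_par P1 Q1)].
  + by apply: (linear_subD (PL true)); [apply: (ls_br_par P0 Q1)|apply: (ls_br_par P1 Q0)].
  + rewrite -[ls_br u0 v0]scale1r; apply: normD; [exact: normB P0 Q0 _ _|exact: normB P1 Q1 _ _].
  + rewrite -[ls_br u0 v1]scale1r; apply: normD; [exact: normB P0 Q1 _ _|exact: normB P1 Q0 _ _].
  by rewrite !brDl !brDr [X in _ + X]addrC addrACA.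
move=> i; have [Pe Pf Ph] := par i.
split; [exists 0, (e i)|exists 0, (f i)|exists (h i), 0]; rewrite ?add0r ?addr0;
  split=> //; try (by case: (PL false)); try (by case: (PL true));
  by move=> z Jz; have [] := Jg i z Jz.
Qed.

End Brackets.

Lemma ord3P (i j k l : 'I_3) : i != j -> i != k -> j != k ->
  l = i \/ l = j \/ l = k.
Proof.
move=> ij ik jk; have us : uniq [:: i; j; k] by rewrite /= !inE negb_or ij ik jk.
have [||_ /(_ l)] := uniq_min_size (s2 := enum 'I_3) us; first by move=> x; rewrite mem_enum.
  by rewrite size_enum_ord.
by rewrite mem_enum !inE => /or3P[]/eqP; auto.
Qed.

(* The properties of the Cartan matrix used below; they are invariant under
   permutations of the indices and under A |-> - A, and so is what follows. *)
Definition D21_matrix (F : fieldType) (A : 'M[F]_3) : Prop :=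
  [/\ forall i, A i i = 0, forall i j, A i j = A j i,
      forall i j, i != j -> A i j != 0,
      forall i j k, i != j -> i != k -> j != k -> A i j + A i k + A j k = 0
    & forall d : 'I_3 -> F, exists c : 'I_3 -> F, forall j, \sum_l c l * A l j = d j].

(** What is kept of [contragredient] after forgetting the presented algebra: maximality of the
    kernel becomes the absence of nonzero ideals avoiding the Cartan subalgebra. *)
Definition D21_like (F : numFieldType) (A : 'M[F]_3) (g : lieSuper F)
    (e f h : 'I_3 -> g) : Prop :=
  [/\ D21_matrix A, chevalley_relations A e f h, generated e f h,
      forall J : set g, ideal J -> meets_trivially J (cartan h) -> J `<=` [set 0]
    & forall i, h i <> 0].

(** The bracket of odd elements is symmetric, so [f_i, e_j] gives the same [h i]; only the
    eigenvalues of [h] change sign. *)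
Lemma D21_like_swap (F : numFieldType) (A : 'M[F]_3) (g : lieSuper F)
    (e f h : 'I_3 -> g) : D21_like A e f h -> D21_like (- A) f e h.
Proof.
case=> [[A0 AC An0 As AH] [par hh ef he hf] gen J0 h0]; split=> //.
- split=> [i|i j|i j ij|i j k ij ik jk|d].
  + by rewrite mxE A0 oppr0.
  + by rewrite !mxE AC.
  + by rewrite mxE oppr_eq0 An0.
  + by rewrite !mxE -!opprD As // oppr0.
  have [c cE] := AH d; exists (fun l => - c l) => j.
  by rewrite -cE; apply: eq_bigr => l _; rewrite mxE mulrNN.
- split=> // [i|i j|i j|i j]; first by have [] := par i.
  + have [[Pe _ _] [_ Pf _]] := (par j, par i).
    by rewrite (br_oddC Pf Pe) ef eq_sym; case: eqP => // ->.
  + by rewrite mxE scaleNr hf.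
  by rewrite mxE scaleNr opprK he.
by move=> W WL WB Wg; apply: gen => // i; have [] := Wg i.
Qed.

(** * Relations among the [e i], obtained from singular elements *)

Section D21Upper.
Variables (F : numFieldType) (A : 'M[F]_3) (g : lieSuper F) (e f h : 'I_3 -> g).
Hypothesis D : D21_like A e f h.

Let A0 : forall i, A i i = 0. Proof. by case: D => -[]. Qed.
Let AC : forall i j, A i j = A j i. Proof. by case: D => -[]. Qed.
Let An0 : forall i j, i != j -> A i j != 0. Proof. by case: D => -[]. Qed.
Let As : forall i j k, i != j -> i != k -> j != k -> A i j + A i k + A j k = 0.
Proof. by case: D => -[]. Qed.
Let Pe i : ls_par true (e i). Proof. by case: D => _ [/(_ i)[]]. Qed.
Let Pf i : ls_par true (f i). Proof. by case: D => _ [/(_ i)[]]. Qed.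
Let Ph i : ls_par false (h i). Proof. by case: D => _ [/(_ i)[]]. Qed.
Let hh i j : ls_br (h i) (h j) = 0. Proof. by case: D => _ []. Qed.
Let ef i j : ls_br (e i) (f j) = if i == j then h i else 0. Proof. by case: D => _ []. Qed.
Let he i j : ls_br (h i) (e j) = A i j *: e j. Proof. by case: D => _ []. Qed.
Let hf i j : ls_br (h i) (f j) = - (A i j *: f j). Proof. by case: D => _ []. Qed.
Let fe i j : ls_br (f i) (e j) = if i == j then h i else 0.
Proof. by rewrite br_oddC // ef eq_sym; case: eqP => // ->. Qed.
Let eh i j : ls_br (e i) (h j) = - (A j i *: e i).
Proof. by rewrite (br_evenC (Pe i) (Ph j)) he. Qed.

Lemma cartan_elt_exists (d : 'I_3 -> F) : exists c, forall j,
  ls_br (cartan_elt h c) (e j) = d j *: e j /\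
  ls_br (cartan_elt h c) (f j) = - d j *: f j.
Proof.
case: D => -[_ _ _ _ /(_ d)[c cE]] _ _ _ _; exists c => j.
rewrite /cartan_elt !(linear_sum _ _ _ (ls_brDl _)) -cE scaleNr !scaler_suml -sumrN.
by split; apply: eq_bigr => l _; rewrite brZl ?he ?hf ?scalerN scalerA.
Qed.

(* The ideal generated by x lies in positive degrees, hence avoids the Cartan
   subalgebra. *)
Lemma singular_eq0 a (x : g) (d : int) :
    ls_par a x -> (forall i, exists b, ls_br (h i) x = b *: x) ->
    (forall c, (forall j, ls_br (cartan_elt h c) (e j) = e j) ->
       ls_br (cartan_elt h c) x = d%:~R *: x) ->
    0 < d -> (forall j, ls_br (f j) x = 0) ->
  x = 0.
Proof.
move=> Px hx dx d0 fx; have [_ [par _ _ _ _] gen J0 _] := D.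
pose J := [set y : g | forall X : set g, linear_sub X -> X x ->
  (forall i y, X y -> X (ls_br (e i) y)) -> X y].
have JL : linear_sub J.
  split=> [X [] //|b u v Ju Jv X XL Xx Xe].
  by apply: XL.2; [apply: Ju|apply: Jv].
have Jx : J x by [].
have Je i y : J y -> J (ls_br (e i) y).
  by move=> Jy X XL Xx Xe; apply: (Xe); apply: Jy.
(* Stability under [f] and under [h] must be proved together, since [f_i, [e_i, z]] produces
   [h_i, z]. *)
have Jfh y : J y -> [/\ J y, forall i, J (ls_br (f i) y) & forall i, J (ls_br (h i) y)].
  move=> Jy; apply: (Jy [set y | [/\ J y, forall i, J (ls_br (f i) y) &
    forall i, J (ls_br (h i) y)]]) => [||j z [Jz Jf Jh]].
  - split=> [|b u v [Ju Jfu Jhu] [Jv Jfv Jhv]] /=.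
      by split=> [|i|i]; rewrite ?br0r; case: JL.
    by split=> [|i|i]; rewrite ?ls_brDr; apply: JL.2.
  - by split=> // i; [rewrite fx; case: JL|have [b ->] := hx i; apply: (linear_subZ _ JL)].
  split=> [|i|i]; first exact: Je.
    rewrite br_oddJ // fe; apply: (linear_subB JL); last exact: Je.
    by case: eqP => _; [exact: Jh|rewrite br0l; case: JL].
  rewrite ls_brJ_even // he brZl; apply: (linear_subD JL); last exact: Je.
  by apply: (linear_subZ _ JL); apply: Je.
have Jideal : ideal J.
  split; last first.
    apply: (generated_stable gen par JL) => i y Jy.
    by have [_ Jf Jh] := Jfh y Jy; split=> //; apply: Je.
  have [PL _ _] := ls_parP g.
  split=> // y Jy; apply: (Jy [set y | exists v0 v1,
      [/\ ls_par false v0, ls_par true v1, J v0, J v1 & y = v0 + v1]]).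
  - split=> [|b _ _ [u0 [u1 [? ? ? ? ->]]] [v0 [v1 [? ? ? ? ->]]]] /=.
      by exists 0, 0; rewrite addr0; split=> //; [case: (PL false)|case: (PL true)|case: JL|case: JL].
    exists (b *: u0 + v0), (b *: u1 + v1).
    split; [exact: (PL _).2|exact: (PL _).2|exact: JL.2|exact: JL.2|].
    by rewrite scalerDr addrACA.
  - have J00 : J 0 by case: JL.
    case: (a) Px => Px; [exists 0, x|exists x, 0]; rewrite ?add0r ?addr0; split=> //.
      by case: (PL false).
    by case: (PL true).
  move=> i z [v0 [v1 [P0 P1 J0' J1 ->]]]; exists (ls_br (e i) v1), (ls_br (e i) v0).
  rewrite brDr addrC; split=> //; try exact: Je.
    exact: (ls_br_par (Pe i) P1).
  exact: (ls_br_par (Pe i) P0).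
have [c cE] := cartan_elt_exists (fun=> 1).
pose H := cartan_elt h c.
have He j : ls_br H (e j) = e j by have [-> _] := cE j; rewrite scale1r.
have Heven : ls_par false H by apply: cartan_elt_even.
apply: (J0 J Jideal _ x Jx); apply/seteqP; split=> [y [Jy hy]|_ ->]; last first.
  by split; [case: JL|case: (lspan_sub (range h))].
pose E := [set q : F | exists2 m : int, 0 < m & q = m%:~R].
apply: (@eigsp_lspan0 _ _ _ (ls_brDr H) E 0).
- by case=> m m0 /esym/eqP; rewrite intr_eq0 => /eqP m0'; rewrite m0' ltxx in m0.
- apply: (Jy (lspan [set u | exists2 q, E q & eigsp (ls_br H) q u])) => [||i z Ez].
  + exact: lspan_sub.
  + by apply: lspan_incl; exists d%:~R; [exists d|apply: dx].
  apply: (Ez [set z | lspan [set u | exists2 q, E q & eigsp (ls_br H) q u] (ls_br (e i) z)]).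
    split=> [|b u v] /=; last by rewrite ls_brDr; apply: (lspan_sub _).2.
    by rewrite br0r; case: (lspan_sub [set u | exists2 q, E q & eigsp (ls_br H) q u]).
  move=> u [_ [m m0 ->] um] /=; apply: lspan_incl; exists (m + 1)%:~R.
    by exists (m + 1) => //; apply: addr_gt0.
  by rewrite /eigsp /= ls_brJ_even // He um brZr intrD scalerDl scale1r addrC.
apply: (hy (eigsp (ls_br H) 0)); first exact: (eigsp_sub (ls_brDr H)).
by move=> _ [i _ <-]; rewrite /eigsp /= cartan_elt_comm // scale0r.
Qed.

(** The bracket of [e_i, e_i] with f_i is 2 a_ii e_i, which is 0 because the simple root is
    isotropic. *)
Lemma br_ee i : ls_br (e i) (e i) = 0.
Proof.
apply: (@singular_eq0 false _ 2) => //; first exact: (ls_br_par (Pe i) (Pe i)).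
- move=> l; exists (A l i + A l i).
  by rewrite ls_brJ_even // he brZl brZr -scalerDl.
- move=> c cE; have Hev : ls_par false (cartan_elt h c) by apply: cartan_elt_even.
  by rewrite ls_brJ_even // cE -mulr2n -scaler_nat.
move=> j; rewrite br_oddJ // fe; case: eqP => [->|_]; last by rewrite br0l br0r subrr.
by rewrite he eh A0 scale0r oppr0 subrr.
Qed.

Lemma br_h_ee l i j : ls_br (h l) (ls_br (e i) (e j)) = (A l i + A l j) *: ls_br (e i) (e j).
Proof. by rewrite ls_brJ_even // !he brZl brZr scalerDl. Qed.

Lemma br_f_ee l i j : ls_br (f l) (ls_br (e i) (e j)) =
  (if l == i then A l j *: e j else 0) + (if l == j then A l i *: e i else 0).
Proof.
rewrite br_oddJ // !fe; congr (_ + _); case: eqP => [->|_].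
- by rewrite he.
- by rewrite br0l.
- by rewrite eh opprK.
- by rewrite br0r oppr0.
Qed.

Lemma br_eee_repeat i j : [/\ ls_br (e i) (ls_br (e i) (e j)) = 0,
  ls_br (e i) (ls_br (e j) (e i)) = 0 & ls_br (e i) (ls_br (e j) (e j)) = 0].
Proof. by rewrite (br_oddC (Pe j)) // br_ee br0r br_odd_sqr0 // br_ee. Qed.

(* Both sides have the same bracket with every f l. *)
Lemma br_eeeC i j k : i != j -> i != k -> j != k ->
  A i k *: ls_br (e i) (ls_br (e j) (e k)) = A j k *: ls_br (e j) (ls_br (e i) (e k)).
Proof.
move=> ij ik jk; apply/subr0_eq.
have Peee a b c : ls_par true (ls_br (e a) (ls_br (e b) (e c))).
  exact: (ls_br_par (Pe a) (ls_br_par (Pe b) (Pe c))).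
have [PL _ _] := ls_parP g.
apply: (@singular_eq0 true _ 3) => //.
- by apply: (linear_subB (PL true)); apply: (linear_subZ _ (PL true)).
- move=> l; exists (A l i + (A l j + A l k)).
  have h3 a b b' : ls_br (h l) (ls_br (e a) (ls_br (e b) (e b'))) =
      (A l a + (A l b + A l b')) *: ls_br (e a) (ls_br (e b) (e b')).
    by rewrite ls_brJ_even // br_h_ee he brZl brZr -scalerDl.
  rewrite brDr brNr !brZr !h3 [A l j + (A l i + _)]addrCA scalerBr !scalerA.
  by rewrite ![_ * (A l i + _)]mulrC.
- move=> c cE; have Hev : ls_par false (cartan_elt h c) by apply: cartan_elt_even.
  have D2 a b : ls_br (cartan_elt h c) (ls_br (e a) (e b)) = 2 *: ls_br (e a) (e b).
    by rewrite ls_brJ_even // !cE -mulr2n -scaler_nat.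
  have D3 a b b' : ls_br (cartan_elt h c) (ls_br (e a) (ls_br (e b) (e b'))) =
      3 *: ls_br (e a) (ls_br (e b) (e b')).
    by rewrite ls_brJ_even // cE D2 brZr [in RHS](natrD _ 1 2) [RHS]scalerDl scale1r.
  by rewrite brDr brNr !brZr !D3 scalerBr !scalerA ![_ * 3]mulrC.
(* The brackets of the difference with f_i and f_j are multiples of this sum; with f_k they cancel
   by symmetry of the matrix. *)
have S := As ij ik jk.
have f3 l a b c : ls_br (f l) (ls_br (e a) (ls_br (e b) (e c))) =
    (if l == a then (A a b + A a c) *: ls_br (e b) (e c) else 0) -
    ((if l == b then A l c *: ls_br (e a) (e c) else 0) +
     (if l == c then A l b *: ls_br (e a) (e b) else 0)).
  rewrite br_oddJ // fe br_f_ee brDr; congr (_ - (_ + _)); case: eqP => [->|_].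
  - by rewrite br_h_ee.
  - by rewrite br0l.
  - by rewrite brZr.
  - by rewrite br0r.
  - by rewrite brZr.
  - by rewrite br0r.
move=> l; rewrite brDr brNr !brZr !f3.
have nji : j != i by rewrite eq_sym.
have nki : k != i by rewrite eq_sym.
have nkj : k != j by rewrite eq_sym.
case: (eqVneq l i) => [->|li].
  rewrite (negbTE ij) (negbTE ik) !addr0 subr0 !add0r scalerN opprK !scalerA -scalerDl.
  have -> : A i k * (A i j + A i k) + A j k * A i k = A i k * (A i j + A i k + A j k).
    by rewrite [in RHS]mulrDr [A j k * _]mulrC.
  by rewrite S mulr0 scale0r.
case: (eqVneq l j) => [->|lj].
  rewrite (negbTE jk) !addr0 subr0 add0r scalerN -opprD !scalerA -scalerDl [A j i]AC.
  have -> : A i k * A j k + A j k * (A i j + A j k) = A j k * (A i j + A i k + A j k).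
    by rewrite mulrC -mulrDr addrCA addrA.
  by rewrite S mulr0 scale0r oppr0.
case: (eqVneq l k) => [->|lk]; last by rewrite !addr0 !subr0 !scaler0 subr0.
rewrite !add0r !scalerN opprK !scalerA [A k j]AC [A k i]AC (br_oddC (Pe j)) //.
by rewrite [A j k * _]mulrC addNr.
Qed.

Lemma br_eee_prop i j k : i != j -> i != k -> j != k ->
  exists a, ls_br (e i) (ls_br (e j) (e k)) = a *: ls_br (e j) (ls_br (e i) (e k)).
Proof.
move=> ij ik jk; exists ((A i k)^-1 * A j k).
by rewrite -scalerA -br_eeeC // scalerA mulVf ?scale1r ?An0.
Qed.

(** If i, j, k are distinct, [l] is one of them; up to a scalar [e l] can be moved to the front of
    the triple bracket, and (ad e_l)^2 = 0. *)
Lemma br_eeee l i j k : ls_br (e l) (ls_br (e i) (ls_br (e j) (e k))) = 0.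
Proof.
have [<-|ij] := eqVneq i j; first by have [-> _ _] := br_eee_repeat i k; rewrite br0r.
have [<-|ik] := eqVneq i k; first by have [_ -> _] := br_eee_repeat i j; rewrite br0r.
have [<-|jk] := eqVneq j k; first by have [_ _ ->] := br_eee_repeat i j; rewrite br0r.
have sqr0 m z : ls_br (e m) (ls_br (e m) z) = 0 by apply: br_odd_sqr0 => //; apply: br_ee.
case: (ord3P l ij ik jk) => [->|[->|->]].
- exact: sqr0.
- by have [a ->] := br_eee_prop ij ik jk; rewrite brZr sqr0 scaler0.
rewrite (br_oddC (Pe j)) //; have kj : k != j by rewrite eq_sym.
by have [a ->] := br_eee_prop ik ij kj; rewrite brZr sqr0 scaler0.
Qed.

End D21Upper.

Lemma lspan_mono (F : fieldType) (V : lmodType F) (X Y : set V) :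
  X `<=` lspan Y -> lspan X `<=` lspan Y.
Proof. by move=> XY v; apply; first exact: lspan_sub. Qed.

(** Redundant by design: repeated indices give 0 and reorderings give multiples, but the full list
    is visibly symmetric under the exchange of [e] and [f]. *)
Inductive D21_gens (F : numFieldType) (g : lieSuper F) (e f h : 'I_3 -> g) : set g :=
| D21_h i : D21_gens e f h (h i)
| D21_e i : D21_gens e f h (e i)
| D21_f i : D21_gens e f h (f i)
| D21_ee i j : D21_gens e f h (ls_br (e i) (e j))
| D21_ff i j : D21_gens e f h (ls_br (f i) (f j))
| D21_eee i j k : D21_gens e f h (ls_br (e i) (ls_br (e j) (e k)))
| D21_fff i j k : D21_gens e f h (ls_br (f i) (ls_br (f j) (f k))).

Lemma D21_gens_swap (F : numFieldType) (g : lieSuper F) (e f h : 'I_3 -> g) :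
  lspan (D21_gens e f h) `<=` lspan (D21_gens f e h).
Proof. by apply: lspan_mono => _ []; intros; apply: lspan_incl; constructor. Qed.

(** On brackets of [e], ad e_l adds a letter until [br_eeee] stops it; on brackets of [f] it removes
    a letter, by the swapped form of [br_f_ee] and [br_h_ee]. *)
Lemma D21_gens_stable_e (F : numFieldType) (A : 'M[F]_3) (g : lieSuper F)
    (e f h : 'I_3 -> g) (D : D21_like A e f h) l x :
  lspan (D21_gens e f h) x -> lspan (D21_gens e f h) (ls_br (e l) x).
Proof.
set G := D21_gens e f h; have GL : linear_sub (lspan G) := lspan_sub _.
have [_ [par hh ef he hf] _ _ _] := D.
have Pe m : ls_par true (e m) by have [] := par m.
have Pf m : ls_par true (f m) by have [] := par m.
have Ph m : ls_par false (h m) by have [] := par m.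
have Gi y : G y -> lspan G y by apply: lspan_incl.
have G0 : lspan G 0 by case: GL.
have GZ a y : G y -> lspan G (a *: y) by move=> Gy; apply: (linear_subZ _ GL); apply: Gi.
have e_ff := br_f_ee (D21_like_swap D).
move=> Gx; apply: (Gx [set x | lspan G (ls_br (e l) x)]) => [|_ [i|i|i|i j|i j|i j k|i j k]] /=.
- by split=> [|a u v] /=; rewrite ?br0r // brDr brZr; apply: GL.2.
- by rewrite (br_evenC (Pe l) (Ph i)) he -scaleNr; apply: GZ; constructor.
- by apply: Gi; constructor.
- by rewrite ef; case: eqP => // _; apply: Gi; constructor.
- by apply: Gi; constructor.
- by rewrite e_ff; apply: (linear_subD GL); case: eqP => // _; apply: GZ; constructor.
- by rewrite (br_eeee D).
rewrite br_oddJ // e_ff ef; apply: (linear_subB GL).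
  case: eqP => [->|_]; last by rewrite br0l.
  by rewrite (br_h_ee (D21_like_swap D)); apply: GZ; constructor.
rewrite brDr; apply: (linear_subD GL); case: eqP => _; rewrite ?br0r // brZr;
  by apply: GZ; constructor.
Qed.

Section D21Structure.
Variables (F : numFieldType) (A : 'M[F]_3) (g : lieSuper F) (e f h : 'I_3 -> g).
Hypothesis D : D21_like A e f h.
Let Dswap := D21_like_swap D.

Let Pe i : ls_par true (e i). Proof. by case: D => _ [/(_ i)[]]. Qed.
Let Pf i : ls_par true (f i). Proof. by case: D => _ [/(_ i)[]]. Qed.
Let Ph i : ls_par false (h i). Proof. by case: D => _ [/(_ i)[]]. Qed.
Let hh i j : ls_br (h i) (h j) = 0. Proof. by case: D => _ []. Qed.
Let ef i j : ls_br (e i) (f j) = if i == j then h i else 0. Proof. by case: D => _ []. Qed.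
Let fe i j : ls_br (f i) (e j) = if i == j then h i else 0.
Proof. by rewrite br_oddC // ef eq_sym; case: eqP => // ->. Qed.

Lemma D21_span x : lspan (D21_gens e f h) x.
Proof.
have [_ [par _ _ _ _] gen _ _] := D.
have GL : linear_sub (lspan (D21_gens e f h)) := lspan_sub _.
have Ge := D21_gens_stable_e D.
have Gf l y : lspan (D21_gens e f h) y -> lspan (D21_gens e f h) (ls_br (f l) y).
  by move=> Gy; apply: D21_gens_swap; apply: (D21_gens_stable_e Dswap); apply: D21_gens_swap.
(* Since h_l = [e_l, f_l], stability under [h l] follows from that under [e l] and [f l]. *)
have Gh l y : lspan (D21_gens e f h) y -> lspan (D21_gens e f h) (ls_br (h l) y).
  move=> Gy; have -> : ls_br (h l) y = ls_br (e l) (ls_br (f l) y) + ls_br (f l) (ls_br (e l) y).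
    by rewrite br_oddJ // ef eqxx subrK.
  by apply: (linear_subD GL); [by apply: Ge; apply: Gf|by apply: Gf; apply: Ge].
have stable := generated_stable gen par GL (fun i y Gy => And3 (Ge i y Gy) (Gf i y Gy) (Gh i y Gy)).
apply: gen => [//|y z _ Gz|i]; first exact: stable.
by split; apply: lspan_incl; constructor.
Qed.

Section Grading.
Variables (d : 'I_3 -> int) (c : 'I_3 -> F).
Hypotheses (dP : forall i, d i = 1 \/ d i = -1).
Hypothesis cP : forall j, ls_br (cartan_elt h c) (e j) = (d j)%:~R *: e j /\
  ls_br (cartan_elt h c) (f j) = - (d j)%:~R *: f j.
Local Notation gr := (ad_grading h c).

Lemma deg_h i : gr 0 (h i).
Proof. by rewrite /ad_grading /eigsp /= cartan_elt_comm // scale0r. Qed.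

Lemma deg_e i : gr (d i) (e i).
Proof. by have [] := cP i. Qed.

Lemma deg_f i : gr (- d i) (f i).
Proof. by have [_ fi] := cP i; rewrite /ad_grading /eigsp /= fi mulrNz. Qed.

Let deg_br := ad_grading_br (c := c) Ph.

Lemma D21_gr_span x : exists (s : seq int) (y : int -> g),
  (forall j, gr j (y j)) /\ x = \sum_(j <- s) y j.
Proof.
have gL j : linear_sub (gr j) := eigsp_sub (ls_brDr _) _.
(* Generators have at most three letters, each of degree 1 or -1. *)
pose s : seq int := [:: 0; 1; 2; 3; -1; -2; -3].
suff [y [yP xE]] : exists y : int -> g,
    (forall j, gr j (y j)) /\ x = \sum_(j <- s) y j by exists s, y.
have hom j u : j \in s -> gr j u -> exists y : int -> g,
    (forall i, gr i (y i)) /\ u = \sum_(i <- s) y i.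
  move=> js ju; exists (fun i => if i == j then u else 0); split=> [i|].
    by case: eqP => [->|_] //; case: (gL i).
  by rewrite (bigD1_seq j) //= eqxx big1 ?addr0 // => i /negbTE->.
move: (D21_span x) => /(_ [set x | exists y : int -> g,
    (forall j, gr j (y j)) /\ x = \sum_(j <- s) y j]); apply.
  split=> [|a _ _ [y [yP ->]] [z [zP ->]]] /=.
    exists (fun=> 0); split=> [j|]; first by case: (gL j).
    by rewrite big1.
  exists (fun j => a *: y j + z j); split=> [j|]; first exact: (gL j).2.
  by rewrite big_split /= scaler_sumr.
move=> _ [i|i|i|i j|i j|i j k|i j k] /=.
- by apply: (hom 0) => //; apply: deg_h.
- by apply: (hom (d i)); [case: (dP i) => ->|apply: deg_e].
- by apply: (hom (- d i)); [case: (dP i) => ->|apply: deg_f].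
- apply: (hom (d i + d j)); last by apply: deg_br; apply: deg_e.
  by case: (dP i) => ->; case: (dP j) => ->.
- apply: (hom (- d i + - d j)); last by apply: deg_br; apply: deg_f.
  by case: (dP i) => ->; case: (dP j) => ->.
- apply: (hom (d i + (d j + d k))).
    by case: (dP i) => ->; case: (dP j) => ->; case: (dP k) => ->.
  by apply: deg_br; [apply: deg_e|apply: deg_br; apply: deg_e].
apply: (hom (- d i + (- d j + - d k))).
  by case: (dP i) => ->; case: (dP j) => ->; case: (dP k) => ->.
by apply: deg_br; [apply: deg_f|apply: deg_br; apply: deg_f].
Qed.

End Grading.

(** * The Heisenberg-type positive part for the degrees 1, 1, -1 *)

Section Nilradical.
Variables (i j k : 'I_3).
Hypotheses (ij : i != j) (ik : i != k) (jk : j != k).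
Local Notation eij := (ls_br (e i) (e j)).
Local Notation E := (ls_br (e k) eij).

(** Root vectors for beta_i, beta_j, -beta_k and beta_i + beta_j + beta_k, the odd roots of degree
    1. *)
Definition nil_odd : seq g := [:: e i; e j; f k; E].

Lemma nil_odd_par x : x \in nil_odd -> ls_par true x.
Proof.
by rewrite !inE => /or4P[]/eqP-> //; apply: (ls_br_par (Pe k) (ls_br_par (Pe i) (Pe j))).
Qed.

Let fk_eij : ls_br (f k) eij = 0.
Proof. by rewrite (br_f_ee D) ![k == _]eq_sym (negbTE ik) (negbTE jk) addr0. Qed.

Let eij_E : ls_br eij E = 0.
Proof.
have := br_oddJ E (Pe i) (Pe j).
by rewrite !(br_eeee D) !br0r subr0 => /esym.
Qed.

Lemma nil_odd_eij x : x \in nil_odd -> ls_br eij x = 0.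
Proof.
have Pij : ls_par false eij := ls_br_par (Pe i) (Pe j).
have N y : ls_par true y -> ls_br y eij = 0 -> ls_br eij y = 0.
  by move=> Py y0; apply: oppr_inj; rewrite -(br_evenC Py Pij) y0 oppr0.
rewrite !inE => /or4P[]/eqP-> //; apply: N => //.
  by have [-> _ _] := br_eee_repeat D i j.
by have [_ -> _] := br_eee_repeat D j i.
Qed.

(** Only [e i] with [e j], and [f k] with the triple bracket, have roots adding up to beta_i +
    beta_j; all other brackets vanish. *)
Lemma nil_odd_br x y : x \in nil_odd -> y \in nil_odd ->
  exists a, ls_br x y = a *: eij.
Proof.
have PE : ls_par true E := ls_br_par (Pe k) (ls_br_par (Pe i) (Pe j)).
have Z z : z = 0 -> exists a, z = a *: eij by move->; exists 0; rewrite scale0r.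
have fE : exists a, ls_br (f k) E = a *: eij.
  by rewrite br_oddJ // fe eqxx fk_eij br0r subr0 (br_h_ee D); eexists.
have EE : ls_br E E = 0.
  by rewrite br_oddJ // (br_oddC PE (Pe k)) (br_eeee D) br0l (br_evenC PE (ls_br_par (Pe i) (Pe j)))
    eij_E oppr0 br0r subr0.
have fke l : l != k -> ls_br (f k) (e l) = 0 by rewrite fe eq_sym => /negbTE ->.
rewrite !inE => /or4P[]/eqP-> /or4P[]/eqP->.
- by apply: Z; apply: (br_ee D).
- by exists 1; rewrite scale1r.
- by apply: Z; rewrite br_oddC // fke.
- by apply: Z; apply: (br_eeee D).
- by exists 1; rewrite scale1r br_oddC.
- by apply: Z; apply: (br_ee D).
- by apply: Z; rewrite br_oddC // fke.
- by apply: Z; apply: (br_eeee D).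
- by apply: Z; rewrite fke.
- by apply: Z; rewrite fke.
- by apply: Z; apply: (br_ee Dswap).
- exact: fE.
- by apply: Z; rewrite br_oddC // (br_eeee D).
- by apply: Z; rewrite br_oddC // (br_eeee D).
- by rewrite br_oddC.
exact: Z.
Qed.

Lemma eee_propE l m p : l != m -> l != p -> m != p ->
  exists a, ls_br (e l) (ls_br (e m) (e p)) = a *: E.
Proof.
have C a b : ls_br (e a) (e b) = ls_br (e b) (e a) by apply: br_oddC.
have ki : k != i by rewrite eq_sym.
have kj : k != j by rewrite eq_sym.
have ji : j != i by rewrite eq_sym.
have [ai Ei] := br_eee_prop D ik ij kj; have [aj Ej] := br_eee_prop D jk ji ki.
case: (ord3P l ij ik jk) => [->|[->|->]]; case: (ord3P m ij ik jk) => [->|[->|->]];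
  case: (ord3P p ij ik jk) => [->|[->|->]]; rewrite ?eqxx // => _ _ _.
- by exists ai; rewrite C.
- by exists ai.
- by exists aj; rewrite C Ej [ls_br (e j) (e i)]C.
- by exists aj; rewrite Ej [ls_br (e j) (e i)]C.
- by exists 1; rewrite scale1r.
by exists 1; rewrite scale1r C.
Qed.

Variables (d : 'I_3 -> int) (c : 'I_3 -> F).
Hypotheses (di : d i = 1) (dj : d j = 1) (dk : d k = -1).
Hypothesis cP : forall j, ls_br (cartan_elt h c) (e j) = (d j)%:~R *: e j /\
  ls_br (cartan_elt h c) (f j) = - (d j)%:~R *: f j.
Local Notation gr := (ad_grading h c).

(** By [eigsp_lspan] only generators of degree [m] contribute, and each generator lies in [N] or has
    degree at most 0. Repeated indices are discarded first: [f_k, f_k] would have degree 2, but it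
    is 0. *)
Lemma nilradical_span (m : int) x : 0 < m -> gr m x ->
  lspan [set y | y \in eij :: nil_odd] x.
Proof.
set N := lspan _ => m0 xm; have NL : linear_sub N := lspan_sub _.
have N0 : N 0 by case: NL.
have Nin y : y \in eij :: nil_odd -> N y by apply: lspan_incl.
have Ni : N (e i) by apply: Nin; rewrite !inE eqxx !orbT.
have Nj : N (e j) by apply: Nin; rewrite !inE eqxx !orbT.
have Nk : N (f k) by apply: Nin; rewrite !inE eqxx !orbT.
have NE : N E by apply: Nin; rewrite !inE eqxx !orbT.
have Nij : N eij by apply: Nin; rewrite !inE eqxx.
have de l := deg_e cP l; have df l := deg_f cP l.
have deg_br := ad_grading_br (c := c) Ph.
have deg_gens y : D21_gens e f h y -> N y \/ exists2 q : int, q <= 0 & gr q y.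
  have lP l := ord3P l ij ik jk.
  case=> [l|l|l|l l'|l l'|l l' l''|l l' l''].
  - by right; exists 0 => //; apply: deg_h.
  - case: (lP l) => [->|[->|->]]; [by left|by left|right].
    by exists (d k); [rewrite dk|apply: de].
  - case: (lP l) => [->|[->|->]]; [right|right|by left].
      by exists (- d i); [rewrite di|apply: df].
    by exists (- d j); [rewrite dj|apply: df].
  - have [->|ll'] := eqVneq l l'; first by left; rewrite (br_ee D).
    have [deg|] := leP (d l + d l') 0; first by right; exists (d l + d l') => //; apply: deg_br.
    move: ll'; case: (lP l) => [->|[->|->]]; case: (lP l') => [->|[->|->]];
      rewrite ?di ?dj ?dk ?eqxx //; left => //.
    by rewrite br_oddC.
  - have [->|ll'] := eqVneq l l'; first by left; rewrite (br_ee Dswap).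
    right; exists (- d l + - d l'); last exact: deg_br.
    by move: ll'; case: (lP l) => [->|[->|->]]; case: (lP l') => [->|[->|->]];
      rewrite ?di ?dj ?dk ?eqxx.
  - have [->|ll'] := eqVneq l l'; first by left; have [-> _ _] := br_eee_repeat D l' l''.
    have [->|ll''] := eqVneq l l''; first by left; have [_ -> _] := br_eee_repeat D l'' l'.
    have [->|l'l''] := eqVneq l' l''; first by left; have [_ _ ->] := br_eee_repeat D l l''.
    by left; have [a ->] := eee_propE ll' ll'' l'l''; apply: (linear_subZ _ NL).
  have [->|ll'] := eqVneq l l'; first by left; have [-> _ _] := br_eee_repeat Dswap l' l''.
  have [->|ll''] := eqVneq l l''; first by left; have [_ -> _] := br_eee_repeat Dswap l'' l'.
  have [->|l'l''] := eqVneq l' l''; first by left; have [_ _ ->] := br_eee_repeat Dswap l l''.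
  right; exists (- d l + (- d l' + - d l'')); last by apply: (deg_br) => //; apply: deg_br.
  by move: ll' ll'' l'l''; case: (lP l) => [->|[->|->]]; case: (lP l') => [->|[->|->]];
    case: (lP l'') => [->|[->|->]]; rewrite ?di ?dj ?dk ?eqxx.
have eig y : D21_gens e f h y -> exists q, eigsp (ls_br (cartan_elt h c)) q y.
  case=> *; eexists.
  - exact: deg_h.
  - exact: de.
  - exact: df.
  - exact: deg_br (de _) (de _).
  - exact: deg_br (df _) (df _).
  - exact: deg_br (de _) (deg_br _ _ _ _ (de _) (de _)).
  - exact: deg_br (df _) (deg_br _ _ _ _ (df _) (df _)).
apply: (eigsp_lspan (ls_brDr _) eig (D21_span x) xm) => // y [/deg_gens[//|[q q0 yq]] ym].
suff -> : y = 0 by [].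
have /eqP : (m%:~R - q%:~R) *: y = 0 :> g by rewrite scalerBl -yq -ym subrr.
rewrite scaler_eq0 subr_eq0 => /orP[/eqP/intr_inj mq|/eqP //].
by rewrite mq ltNge q0 in m0.
Qed.

End Nilradical.

End D21Structure.

Lemma D21_cartan_matrix (F : numFieldType) (alpha : F) :
  alpha != 0 -> alpha != -1 -> D21_matrix (D21_cartan alpha).
Proof.
move=> a0 a1; have b0 : - alpha - 1 != 0 by rewrite -opprD oppr_eq0 addr_eq0.
split.
- by case=> [[|[|[|//]]] ?]; rewrite mxE.
- by case=> [[|[|[|//]]] ?] [[|[|[|//]]] ?]; rewrite !mxE.
- by case=> [[|[|[|//]]] ?] [[|[|[|//]]] ?] // _; rewrite !mxE //= oner_eq0.
- by case=> [[|[|[|//]]] ?] [[|[|[|//]]] ?] [[|[|[|//]]] ?] // _ _ _; rewrite !mxE /=; ring.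
move=> d; pose d0 := d 0; pose d1 := d 1; pose d2 := d 2.
(* The solution of the linear system by elimination; its determinant is 2 alpha (- alpha - 1). *)
exists (fun l : 'I_3 => [:: (alpha * d1 + d2 - (- alpha - 1) * d0) / (2 * alpha);
  ((- alpha - 1) * d0 + d2 - alpha * d1) / (2 * (- alpha - 1));
  ((- alpha - 1) * d0 + alpha * d1 - d2) / (2 * alpha * (- alpha - 1))]`_l) => j.
have -> : d j = [:: d0; d1; d2]`_j.
  by case: j => [[|[|[|//]]] ?]; congr d; apply: val_inj.
rewrite !big_ord_recl big_ord0 !mxE /=.
by case: j => [[|[|[|//]]] ?] /=; field; rewrite ?a0 ?b0.
Qed.

(** Let [J] be an ideal of [g] avoiding the Cartan subalgebra. A Cartan element of [gt] mapped into
    [J] has image 0, so it lies in the kernel of [pi] and is itself 0. The preimage of [J] thus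
    falls under maximality and is contained in the kernel. *)
Lemma contragredient_D21_like (F : numFieldType) (A : 'M[F]_3) (g : lieSuper F)
    (e f h : 'I_3 -> g) :
  D21_matrix A -> contragredient A e f h -> D21_like A e f h.
Proof.
move=> DA [hI [gt [et [ft [ht [pi [[[par hh ef he hf] gen _] [[piL piP piB] piS] piE pi0 piM]]]]]]].
have [pi_0 piD piZ piN] := linear_raddf piL.
have piEe i : pi (et i) = e i by have [] := piE i.
have piEf i : pi (ft i) = f i by have [] := piE i.
have piEh i : pi (ht i) = h i by have [] := piE i.
split=> //.
- split=> [i|i j|i j|i j|i j].
  + by have [Pe Pf Ph] := par i; rewrite -piEe -piEf -piEh; split; apply: piP.
  + by rewrite -!piEh -piB hh.
  + by rewrite -piEe -piEf -piB ef; case: eqP => _ //; rewrite piEh.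
  + by rewrite -piEh -piEe -piB he piZ.
  + by rewrite -piEh -piEf -piB hf piN piZ.
- move=> W WL WB Wg x; have [y <-] := piS x.
  apply: (gen [set y | W (pi y)]) => [|u v Wu Wv|i] /=.
  + by split=> [|a u v Wu Wv] /=; [rewrite pi_0; case: WL|rewrite piL; apply: WL.2].
  + by rewrite piB; apply: WB.
  by rewrite piEe piEf piEh.
- move=> J [[JL JG] JB] Jh z Jz /=; have [y yz] := piS z; rewrite -yz.
  apply: (piM [set y | J (pi y)]) => [||/=]; last by rewrite yz.
    split; last by move=> u v /= Jv; rewrite piB; apply: JB.
    split=> [|u Ju].
      by split=> [|a u v Ju Jv] /=; [rewrite pi_0; case: JL|rewrite piL; apply: JL.2].
    have [u0 [u1 [P0 P1 uE]]] := grading2 u (ls_parP gt).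
    have [j0 [j1 [Q0 Q1 J0 J1 jE]]] := JG _ Ju.
    have [PL _ _] := ls_parP g.
    have [|/subr0_eq E0 /subr0_eq E1] := graded2_indep (ls_parP g)
        (linear_subB (PL false) (piP _ _ P0) Q0) (linear_subB (PL true) (piP _ _ P1) Q1).
      by rewrite addrACA -opprD -jE -piD -uE subrr.
    by exists u0, u1; split=> //=; rewrite ?E0 ?E1.
  apply/seteqP; split=> [u [/= Ju hu]|_ -> /=]; last first.
    by split=> /=; [rewrite pi_0; case: JL|case: (lspan_sub (range ht))].
  have hpi : cartan h (pi u).
    apply: (hu [set u | cartan h (pi u)]) => [|_ [i _ <-] /=].
      split=> [|a v w] /=; first by rewrite pi_0; case: (lspan_sub (range h)).
      by rewrite piL; apply: (lspan_sub _).2.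
    by apply: lspan_incl; exists i.
  have : ([set y | pi y = 0] `&` cartan ht) u.
    split=> //=; have : (J `&` cartan h) (pi u) by [].
    by rewrite Jh.
  by rewrite pi0.
move=> i hi0; have := hI (fun j => (j == i)%:R) _ i.
rewrite eqxx (bigD1 i) //= hi0 scaler0 add0r big1 => [/(_ erefl)/eqP|j /negbTE->].
  by rewrite oner_eq0.
by rewrite scale0r.
Qed.

(** * Cuspidal modules *)

Section WeightModules.
Variables (F : numFieldType) (n : nat) (g : lieSuper F) (h : 'I_n -> g).
Hypothesis h_even : forall i, ls_par false (h i).
Variable M : smod (full g).

Lemma weight_shift x (ga mu : 'rV[F]_n) (m : M) :
    (forall i, ls_br (h i) x = ga 0 i *: x) ->
  weight_space h M mu m -> weight_space h M (mu + ga) (sm_act x m).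
Proof.
move=> hx mE i; rewrite sm_act_br_even // hx mE.
have [_ _ -> _] := linear_raddf (sm_act_linearl m).
have [_ _ -> _] := linear_raddf (@sm_act_linear _ _ M x).
by rewrite -scalerDl mxE addrC.
Qed.

(** [x] sends the weight components of [v] into distinct weight spaces, so it kills each of them. *)
Lemma weight_ker x (ga : 'rV[F]_n) (v : M) :
    weight_module h M -> (forall i, ls_br (h i) x = ga 0 i *: x) ->
    sm_act x v = 0 -> v <> 0 ->
  exists mu m, [/\ weight_space h M mu m, sm_act x m = 0 & m <> 0].
Proof.
move=> MW hx xv v0; have [_ _ MI] := MW.
have [s [y [us yE vE]]] := grading_uniq v MW.
have [mu smu y0] : exists2 mu, mu \in s & y mu <> 0.
  apply: contrapT => ny; apply: v0; rewrite vE big_seq big1 // => mu smu.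
  by apply: contrapT => ymu; apply: ny; exists mu.
exists mu, (y mu); split=> //.
rewrite -[mu](addrK ga).
apply: (MI (map (+%R^~ ga) s) (fun nu => sm_act x (y (nu - ga)))).
- by rewrite map_inj_uniq //; apply: addIr.
- by move=> nu; rewrite -{1}[nu](subrK ga); apply: weight_shift.
- rewrite big_map -[RHS]xv vE (linear_sum _ _ _ (@sm_act_linear _ _ M x)).
  by apply: eq_bigr => nu _; rewrite addrK.
exact: map_f.
Qed.

(* Apply the elements of L in turn, as long as the result is nonzero. *)
Lemma anticommuting_kernel (K : set M) (L : seq g) v :
    (forall x m, x \in L -> K m -> K (sm_act x m)) ->
    (forall x y m, x \in L -> y \in L -> K m ->
       sm_act x (sm_act y m) = - sm_act y (sm_act x m)) ->
    K v -> v <> 0 ->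
  exists w, [/\ K w, w <> 0 & forall x, x \in L -> sm_act x w = 0].
Proof.
move=> KL Lanti Kv v0.
suff H (L' : seq g) : {subset L' <= L} ->
    exists w, [/\ K w, w <> 0 & forall x, x \in L' -> sm_act x w = 0] by exact: H.
elim: L' => [_|x L' IH xL]; first by exists v.
have Lx : x \in L by apply: xL; rewrite mem_head.
have L'L : {subset L' <= L} by move=> y yL'; apply: xL; rewrite inE yL' orbT.
have [w [Kw w0 L'w]] := IH L'L.
have [xw|xw] := pselect (sm_act x w = 0).
  by exists w; split=> // y; rewrite inE => /orP[/eqP->|/L'w].
exists (sm_act x w); split=> //; first exact: KL.
move=> y; rewrite inE => /orP[/eqP->|yL'].
  (* Anticommuting with itself, [x] squares to 0 on [K]. *)
  by apply: addv_self0; apply: Lanti.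
rewrite (Lanti _ _ _ (L'L _ yL') Lx Kw) L'w //.
by have [-> _ _ _] := linear_raddf (@sm_act_linear _ _ M x); rewrite oppr0.
Qed.

End WeightModules.

Lemma ord3_third (i j : 'I_3) : exists2 k, i != k & j != k.
Proof.
by case: i j => [[|[|[|//]]] ?] [[|[|[|//]]] ?];
  first [by exists 0|by exists 1|by exists 2].
Qed.

Section CuspidalModule.
Variables (F : numFieldType) (A : 'M[F]_3) (g : lieSuper F) (e f h : 'I_3 -> g).
Hypothesis D : D21_like A e f h.
Variable M : smod (full g).
Hypothesis M_cuspidal : cuspidal h M.

Let Ph i : ls_par false (h i). Proof. by case: D => _ [/(_ i)[]]. Qed.
Let Pe i : ls_par true (e i). Proof. by case: D => _ [/(_ i)[]]. Qed.

Lemma even_root_injective i j (v : M) : i != j ->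
  sm_act (ls_br (e i) (e j)) v = 0 -> v = 0.
Proof.
move=> ij ev; apply: contrapT => v0.
have [M_simple [M_weight _] M_ind] := M_cuspidal.
have [_ [par hh ef he hf] _ _ h0] := D.
have [k ik jk] := ord3_third i j.
pose d (l : 'I_3) : int := if l == k then -1 else 1.
have di : d i = 1 by rewrite /d (negbTE ik).
have dj : d j = 1 by rewrite /d (negbTE jk).
have dk : d k = -1 by rewrite /d eqxx.
have dP l : d l = 1 \/ d l = -1 by rewrite /d; case: eqP; auto.
have [c cP] := cartan_elt_exists D (fun l => (d l)%:~R).
pose H := cartan_elt h c.
have gr_span := D21_gr_span D dP cP.
pose eij := ls_br (e i) (e j).
have Peij : ls_par false eij := ls_br_par (Pe i) (Pe j).
have heij l : ls_br (h l) eij = (\row_m (A m i + A m j)) 0 l *: eij.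
  by rewrite mxE (br_h_ee D).
have [mu [m0 [m0mu em0 m00]]] := weight_ker Ph M_weight heij ev v0.
(* The eigenvalue [t] is left free because each odd element shifts it. *)
pose K := [set m : M | sm_act eij m = 0 /\ exists t, sm_act H m = t *: m].
have act0 x : sm_act x (0 : M) = 0.
  by have [-> _ _ _] := linear_raddf (@sm_act_linear _ _ M x).
have actZl a x (m : M) : sm_act (a *: x) m = a *: sm_act x m.
  by have [_ _ -> _] := linear_raddf (sm_act_linearl m).
have act0l (m : M) : sm_act 0 m = 0.
  by have [-> _ _ _] := linear_raddf (sm_act_linearl m).
have nil_gr x : x \in nil_odd e f i j k -> exists q, ad_grading h c q x.
  have deg_br := ad_grading_br (c := c) Ph.
  rewrite !inE => /or4P[]/eqP->; eexists; [exact: deg_e cP _|exact: deg_e cP _|exact: deg_f cP _|].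
  by apply: (deg_br); [exact: deg_e cP _|apply: deg_br; exact: deg_e cP _].
have [||||w [[ew [t wt]] w0 Lw]] := @anticommuting_kernel _ _ M K (nil_odd e f i j k) m0.
- move=> x m xL [em [t mt]]; split.
    by rewrite sm_act_br_even // (nil_odd_eij D ik jk xL) act0l em act0 addr0.
  have [q xq] := nil_gr x xL; exists (t + q%:~R); exact: ad_shift xq mt.
- move=> x y m xL yL [em _].
  rewrite (sm_act_br _ (nil_odd_par D xL) (nil_odd_par D yL)) /= expr1 scaleN1r.
  by have [a ->] := nil_odd_br D ik jk xL yL; rewrite actZl em scaler0 add0r.
- by split=> //; exists (\sum_l c l * mu 0 l); apply: weight_cartan_elt.
- exact: m00.
have wtop : ad_top h c t w.
  split=> // q x q0 xq.
  move: (nilradical_span D ij ik jk di dj dk cP q0 xq).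
  move=> /(_ [set x | sm_act x w = 0]); apply.
    exact: (linear_ker (sm_act_linearl w)).
  by move=> y; rewrite /= inE => /orP[/eqP->//|/Lw].
apply: (M_ind (ad_parabolic c Ph)).
- exact: ad_parabolicP.
(* [f i] has degree -1, and it is nonzero because [e_i, f_i] = h_i is. *)
- exists (f i); apply: (ad_parabolic_proper (j := - d i)); first by rewrite di.
    exact: deg_f cP i.
  move=> fi0; apply: (h0 i); have := ef i i.
  by rewrite eqxx fi0 br0r.
exact: (ad_parabolically_induced Ph hh gr_span M_simple M_weight w0 wtop).
Qed.

End CuspidalModule.

(** * Equality of dimensions along the even root lattice *)

Section EqualDimensions.
Variables (F : numFieldType) (A : 'M[F]_3) (g : lieSuper F) (e f h : 'I_3 -> g).
Hypothesis D : D21_like A e f h.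
Variable M : smod (full g).
Hypothesis M_cuspidal : cuspidal h M.

Definition same_dim (la mu : 'rV[F]_3) : Prop := exists d : nat,
  has_dim (weight_space h M la) d /\ has_dim (weight_space h M mu) d.

Lemma same_dim_trans la mu nu : same_dim la mu -> same_dim mu nu -> same_dim la nu.
Proof.
case=> [d [la_d mu_d]] [d' [mu_d' nu_d']]; exists d; split=> //.
by rewrite (has_dim_uniq mu_d mu_d').
Qed.

Lemma same_dim_sym la mu : same_dim la mu -> same_dim mu la.
Proof. by case=> [d []]; exists d. Qed.

Lemma same_dim_refl la : same_dim la la.
Proof. by have [_ [_ /(_ la)[d la_d]] _] := M_cuspidal; exists d. Qed.

Lemma same_dim_root i j la : i != j ->
  same_dim la (la + \row_l (A l i + A l j)).
Proof.
move=> ij; set ga := \row_l _; have [_ [_ M_fin] _] := M_cuspidal.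
have [[d la_d] [d' ga_d']] := (M_fin la, M_fin (la + ga)).
have [_ [par _ _ _ _] _ _ _] := D.
have Ph l : ls_par false (h l) by have [] := par l.
have Dswap := D21_like_swap D.
suff dd : d = d' by exists d; split=> //; rewrite dd.
apply/eqP; rewrite eqn_leq; apply/andP; split.
  apply: has_dim_le la_d ga_d'; first exact: (@sm_act_linear _ _ M (ls_br (e i) (e j))).
    move=> m; apply: weight_shift => // l.
    by rewrite mxE (br_h_ee D).
  by move=> m _; apply: (even_root_injective D M_cuspidal).
apply: has_dim_le ga_d' la_d; first exact: (@sm_act_linear _ _ M (ls_br (f i) (f j))).
  move=> m mE; rewrite -[la](addrK ga); apply: weight_shift mE => // l.
  by rewrite !mxE (br_h_ee Dswap) !mxE opprD.
by move=> m _; apply: (even_root_injective Dswap M_cuspidal).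
Qed.

Lemma same_dim_root_int i j la (z : int) : i != j ->
  same_dim la (la + (\row_l (A l i + A l j)) *~ z).
Proof.
move=> ij; set ga := \row_l _.
have N (m : nat) nu : same_dim nu (nu + ga *+ m).
  elim: m => [|m IH]; first by rewrite addr0; apply: same_dim_refl.
  by rewrite mulrSr addrA; apply: same_dim_trans IH _; apply: same_dim_root.
case: z => m; first exact: N.
(* Here z is -(m + 1): the path climbs from [la - ga *+ m.+1] to [la] and is then reversed. *)
by apply: same_dim_sym; rewrite -{2}[la](subrK (ga *+ m.+1)); apply: N.
Qed.

End EqualDimensions.

Theorem corollary3p11 (R : realType) (alpha : R[i])
    (alpha0 : alpha != 0) (alphaN1 : alpha != -1)
    (g : lieSuper R[i]) (e f h : 'I_3 -> g)
    (D21 : contragredient (D21_cartan alpha) e f h)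
    (M : smod (full g)) (M_cuspidal : cuspidal h M)
    (la mu : 'rV[R[i]]_3) (lamu : D21_even_lattice alpha (la - mu)) :
  exists d : nat,
    has_dim (weight_space h M la) d /\ has_dim (weight_space h M mu) d.
Proof.
have D := contragredient_D21_like (D21_cartan_matrix alpha0 alphaN1) D21.
have rootE i j : D21_root alpha i + D21_root alpha j =
    \row_l (D21_cartan alpha l i + D21_cartan alpha l j).
  by apply/rowP => l; rewrite !mxE.
case: lamu => k1 [k2 [k3]]; rewrite !rootE => lamuE.
apply: (same_dim_sym (M := M)).
have -> : la = mu + (la - mu) by rewrite addrC subrK.
have step := same_dim_root_int D M_cuspidal.
rewrite lamuE !addrA.
apply: (same_dim_trans _ (step 1 2 _ k3 isT)).
apply: (same_dim_trans _ (step 0 2 _ k2 isT)).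
exact: step.
Qed.
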